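(* Let $X$ be a compact metric space, $r>0$, and let $\mathcal{U}$ be a good open cover of $X$ such that for every finite subset $\sigma\subset X$: $\sigma$ is contained in some element of $\mathcal{U}$ iff $\operatorname{Diam}(\sigma)<r$. Then there exist finite subsets $X_1\subset X_2\subset X$ such that for every $k\in\mathbb{N}$ and every field $\mathbb{F}$, $H_k(X;\mathbb{F})\cong\operatorname{Im}j_*$, where $j_*\colon H_k(\operatorname{Rips}(X_1,r);\mathbb{F})\to H_k(\operatorname{Rips}(X_2,r);\mathbb{F})$ is induced by the inclusion $\operatorname{Rips}(X_1,r)\hookrightarrow\operatorname{Rips}(X_2,r)$.
   Context: For $A\subset X$, $\operatorname{Rips}(A,r)$ is the simplicial complex with vertex set $A$ whose simplices are the finite subsets of $A$ of diameter $<r$. A cover is good if every finite intersection of its members is empty or contractible. $H_k$ denotes singular (equivalently simplicial) homology. *)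

(* Defs.v *)
From HB Require Import structures.
From mathcomp Require Import all_boot all_order all_algebra.
From Stdlib Require Import Reals ClassicalEpsilon.
From Stdlib Require Lists.List.
Set Implicit Arguments. Unset Strict Implicit. Unset Printing Implicit Defensive.
Import GRing.Theory.

Section Metric.
Local Open Scope R_scope.

Record MetricSpace := {
  mpt :> Type;
  mdist : mpt -> mpt -> R;
  mdist_eq0 : forall x y, mdist x y = 0 <-> x = y;
  mdist_sym : forall x y, mdist x y = mdist y x;
  mdist_tri : forall x y z, mdist x z <= mdist x y + mdist y z
}.

Variable X : MetricSpace.


Definition is_open (U : X -> Prop) : Prop :=
  forall x, U x -> exists e, 0 < e /\ forall y, mdist x y < e -> U y.

Definition compact_space : Prop :=
  forall (I : Type) (U : I -> X -> Prop),
    (forall i, is_open (U i)) -> (forall x, exists i, U i x) ->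
    exists l : list I, forall x, exists i, List.In i l /\ U i x.

Definition contractible (A : X -> Prop) : Prop :=
  exists a0 : X, A a0 /\
  exists H : R -> X -> X,
    (forall t x, 0 <= t <= 1 -> A x -> A (H t x)) /\
    (forall x, A x -> H 0 x = x) /\
    (forall x, A x -> H 1 x = a0) /\
    (forall t x, 0 <= t <= 1 -> A x ->
       forall e, 0 < e -> exists del, 0 < del /\
         forall s y, 0 <= s <= 1 -> A y -> Rabs (t - s) < del -> mdist x y < del ->
           mdist (H t x) (H s y) < e).

Definition open_cover (C : (X -> Prop) -> Prop) : Prop :=
  (forall U, C U -> is_open U) /\ (forall x, exists U, C U /\ U x).

Definition good_cover (C : (X -> Prop) -> Prop) : Prop :=
  forall Us : list (X -> Prop), Us <> nil -> (forall U, List.In U Us -> C U) ->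
    (forall x, ~ (forall U, List.In U Us -> U x)) \/
    contractible (fun x => forall U, List.In U Us -> U x).

Definition diam_lt (s : list X) (r : R) : Prop :=
  forall x y, List.In x s -> List.In y s -> mdist x y < r.

Definition in_Delta (k : nat) (t : list R) : Prop :=
  size t = k.+1 /\ (forall a, List.In a t -> 0 <= a) /\ foldr Rplus 0 t = 1.

End Metric.

(* simp k : raw k-simplices; seqv : when two raw simplices are the same
   simplex; svalid : which raw simplices are actual simplices;
   sface k i : i-th face of a (k+1)-simplex. *)
Record SSet := {
  simp : nat -> Type;
  seqv : forall k, simp k -> simp k -> Prop;
  svalid : forall k, simp k -> Prop;
  sface : forall k, nat -> simp k.+1 -> simp k
}.

Definition decP (P : Prop) : bool :=
  if excluded_middle_informative P then true else false.

Section Chains.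
Local Open Scope ring_scope.
Variables (F : fieldType) (K : SSet).

Definition chain k := seq (F * simp K k).

Definition coef k (c : chain k) (tau : simp K k) : F :=
  \sum_(p <- c) (if decP (seqv p.2 tau) then p.1 else 0).

Definition ceq k (c c' : chain k) : Prop := forall tau, coef c tau = coef c' tau.

Definition valid_chain k (c : chain k) : Prop := forall p, List.In p c -> svalid p.2.

Definition bd k (c : chain k.+1) : chain k :=
  flatten [seq [seq ((-1) ^+ i * p.1, @sface K k i p.2) | i <- iota 0 k.+2] | p <- c].

Definition scale k (a : F) (c : chain k) : chain k := [seq (a * p.1, p.2) | p <- c].

Definition lincomb k (a : seq F) (zs : seq (chain k)) : chain k :=
  flatten [seq scale x.1 x.2 | x <- zip a zs].

Definition csub k (c c' : chain k) : chain k := c ++ scale (-1) c'.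

Definition is_cycle k : chain k -> Prop :=
  match k return chain k -> Prop with
  | 0 => fun c => valid_chain c
  | k'.+1 => fun c => valid_chain c /\ ceq (bd c) [::]
  end.

Definition is_bdry k (c : chain k) : Prop :=
  exists e : chain k.+1, valid_chain e /\ ceq (bd e) c.

End Chains.

Definition cmap (F : fieldType) (K1 K2 : SSet) (f : forall k, simp K1 k -> simp K2 k)
  k (c : chain F K1 k) : chain F K2 k := [seq (p.1, f k p.2) | p <- c].

(* The image of H_k(K1;F) -> H_k(K2;F) induced by the simplex map f has
   dimension n: there are n cycles of K1 whose images form a basis of the
   image (linearly independent modulo boundaries of K2, and spanning the
   image modulo boundaries of K2). *)
Definition image_dim (F : fieldType) (K1 K2 : SSet)
  (f : forall k, simp K1 k -> simp K2 k) (k n : nat) : Prop :=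
  exists zs : seq (chain F K1 k),
    size zs = n /\
    (forall z, List.In z zs -> is_cycle z) /\
    (forall a : seq F, size a = n ->
       is_bdry (cmap f (lincomb a zs)) -> forall x, List.In x a -> x = (GRing.zero : F)) /\
    (forall z : chain F K1 k, is_cycle z ->
       exists a : seq F, size a = n /\ is_bdry (cmap f (csub z (lincomb a zs)))).

Definition homology_dim (F : fieldType) (K : SSet) (k n : nat) : Prop :=
  image_dim F (fun k (s : simp K k) => s) k n.

Definition insert_at (T : Type) (i : nat) (a : T) (l : seq T) : seq T :=
  take i l ++ a :: drop i l.

Definition singular_cont (X : MetricSpace) (k : nat) (sig : list R -> X) : Prop :=
  forall t, in_Delta k t -> forall e, (0 < e)%R -> exists del, (0 < del)%R /\
    forall s, in_Delta k s ->
      (forall i, (i < k.+1)%N -> (Rabs (nth 0%R t i - nth 0%R s i) < del)%R) ->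
      (mdist (sig t) (sig s) < e)%R.

Definition Singular (X : MetricSpace) : SSet := {|
  simp := fun _ => list R -> X;
  seqv := fun k sig tau => forall t, in_Delta k t -> sig t = tau t;
  svalid := fun k sig => @singular_cont X k sig;
  sface := fun k i sig => fun t => sig (insert_at i 0%R t)
|}.

(* ------------- Ordered simplicial chains of Rips(A, r) ----------------- *)
Definition drop_at (T : Type) (i : nat) (l : seq T) : seq T := take i l ++ drop i.+1 l.

Definition Rips (X : MetricSpace) (A : list X) (r : R) : SSet := {|
  simp := fun _ => list X;
  seqv := fun _ s t => s = t;
  svalid := fun k s => size s = k.+1 /\ (forall x, List.In x s -> List.In x A) /\
                       diam_lt s r;
  sface := fun k i s => drop_at i s
|}.

Definition rips_incl (X : MetricSpace) (A B : list X) (r : R) :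
  forall k, simp (Rips A r) k -> simp (Rips B r) k := fun k s => s.

(* Main.v *)
Require Import Defs.
From HB Require Import structures.
From mathcomp Require Import all_boot all_order all_algebra.
From mathcomp Require Import boolp freeg.
From Stdlib Require Import Reals Lra.
From Stdlib Require Lists.List.
From Coquelicot Require Compactness.
Set Implicit Arguments. Unset Strict Implicit. Unset Printing Implicit Defensive.
Import GRing.Theory.
Delimit Scope nat_scope with N.

(** Chains are taken with an extra empty simplex in degree 0, i.e. complexes are
    augmented. For a finite cover D of X by members of C let S(D) be the singular
    chains each of whose simplices lies in a member of D, and V(A, D) the chains on
    tuples of points of A lying in a member of D. Sending a singular simplex to the
    tuple of its vertices is a chain map S(D) -> V(X, D). On a single nonempty finite
    intersection of members of D both sides are acyclic (by contractibility, resp. by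
    coning), so by Mayer-Vietoris for mapping cones it is a quasi-isomorphism. The
    same argument applies to the inclusion V(A, D) -> V(X, D) as soon as A meets every
    nonempty finite intersection, and S(D) computes the homology of X by barycentric
    subdivision. Hence V(A, D) computes the homology of X, naturally in A and D.

    Take D1 a finite subcover, X1 finite meeting its intersections, D2 containing D1
    and a member around each simplex of Rips(X1, r), and X2 containing X1 and meeting
    the intersections of D2. Then V(X1, D1) -> Rips(X1, r) -> V(X2, D2) -> Rips(X2, r),
    where the composite of the first two maps is a quasi-isomorphism and the last map
    is injective on homology: a chain of Rips(X2, r) is V(X, D3)-small for a larger
    finite D3. So the image of H(Rips(X1, r)) in H(Rips(X2, r)) is H(X). *)

(** * Free modules and Mayer-Vietoris for mapping cones *)

(** The conclusion asks for one [n] serving two complexes, and one list of cycles of V(X1, D1) is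
    used for both; it is finite because a finite sample has finitely many tuples of a given length.
    Two samples are needed because a simplex of Rips(X1, r) lies in a member of the cover but
    perhaps in none of D1: it may carry classes foreign to X, and a cycle becomes homologous to a
    D1-small one only after D2 and X2 give room for the filling. Tuple complexes of two covers are
    compared through singular chains, which can be subdivided whereas a tuple of points cannot.
    Every complex is spanned by a set of basis elements of a free module, so sums and intersections
    of subcomplexes are disjunctions and conjunctions of predicates. The empty simplex makes the
    local comparison uniform: over an empty intersection it spans both complexes, and a contractible
    set has no exceptional degree 0. *)

Section FreeModule.
Local Open Scope ring_scope.
Variable F : fieldType.

(* Packing the structure fixes one inheritance path from [fm T] to its group and
   module operations. *)
Definition fm (T : Type) : lmodType F := {freeg {classic T} / F}.

Definition bas (T : Type) (t : T) : fm T := << (t : {classic T}) >>.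

Definition cf (T : Type) (t : T) (z : fm T) : F := coeff (t : {classic T}) z.

Definition lin (T : Type) (V : lmodType F) (f : T -> V) : fm T -> V :=
  fglift (f : {classic T} -> V).

Lemma cf_bas (T : Type) (t u : T) : cf u (bas t) = `[< t = u >]%:R :> F.
Proof.
rewrite /cf /bas coeffU mul1r; congr (nat_of_bool _)%:R.
Qed.

Lemma cf0 (T : Type) (t : T) : cf t 0 = 0.
Proof. exact: coeff0. Qed.

Lemma cfD (T : Type) (t : T) x y : cf t (x + y) = cf t x + cf t y.
Proof. exact: coeffD. Qed.

Lemma cfZ (T : Type) (t : T) a x : cf t (a *: x) = a * cf t x.
Proof. exact: coeffZ. Qed.

Lemma fm_eqP (T : Type) (x y : fm T) : (forall t, cf t x = cf t y) -> x = y.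
Proof. by move=> H; apply/eqP/freeg_eqP. Qed.

Lemma scale_bas (T : Type) (a : F) (t : T) : a *: bas t = << a *g (t : {classic T}) >>.
Proof. by apply: fm_eqP => u; rewrite cfZ /bas /cf !coeffU mul1r. Qed.

(** Only basis elements in the support of [z] are met, which lets [inS_ind] keep track of
    supports. *)
Lemma fm_ind (T : Type) (P : fm T -> Prop) (z : fm T) :
  P 0 -> (forall x y, P x -> P y -> P (x + y)) ->
  (forall a t, cf t z != 0 -> P (a *: bas t)) -> P z.
Proof.
move=> P0 PD PZ; rewrite -[z]freeg_sumE big_seq_cond.
apply: (big_ind (P : {freeg {classic T} / F} -> Prop)) => // t /andP[td _].
by rewrite -(scale_bas _ (t : T)); apply: PZ; rewrite /cf -mem_dom.
Qed.

Section Lin.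
Variables (T : Type) (V : lmodType F) (f : T -> V).

Lemma lin_scaled_bas a (t : T) : lin f (a *: bas t) = a *: f t.
Proof. by rewrite scale_bas /lin liftU. Qed.

Lemma lin_bas t : lin f (bas t) = f t.
Proof. by rewrite -[bas t]scale1r lin_scaled_bas scale1r. Qed.

Lemma lin_is_additive : additive (lin f).
Proof. exact: lift_is_additive. Qed.

HB.instance Definition _ := GRing.isAdditive.Build (fm T) V (lin f) lin_is_additive.

Lemma lin_is_scalable : scalable (lin f).
Proof.
move=> a z; apply: (fm_ind (P := fun z => lin f (a *: z) = a *: lin f z)) => [|x y Hx Hy|b t _].
- by rewrite !raddf0.
- by rewrite !raddfD /= Hx Hy.
- by rewrite scalerA !lin_scaled_bas scalerA.
Qed.

HB.instance Definition _ :=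
  GRing.isScalable.Build F (fm T) V *:%R (lin f) lin_is_scalable.
End Lin.

Definition inS (T : Type) (S : T -> Prop) (z : fm T) : Prop :=
  forall t, cf t z != 0 -> S t.

Section Support.
Variables (T : Type).
Implicit Types (S : T -> Prop) (z : fm T).

Lemma inS0 S : inS S 0.
Proof. by move=> t; rewrite cf0 eqxx. Qed.

Lemma inSD S x y : inS S x -> inS S y -> inS S (x + y).
Proof.
move=> Hx Hy t; rewrite cfD.
case: (eqVneq (cf t x) 0) => [->|nx _]; last exact: Hx.
by rewrite add0r => /Hy.
Qed.

Lemma inSZ S a x : inS S x -> inS S (a *: x).
Proof. by move=> Hx t; rewrite cfZ mulf_eq0 negb_or => /andP[_ /Hx]. Qed.

Lemma inSN S x : inS S x -> inS S (- x).
Proof. by move=> Hx; rewrite -scaleN1r; apply: inSZ. Qed.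

Lemma inSB S x y : inS S x -> inS S y -> inS S (x - y).
Proof. by move=> Hx Hy; apply: inSD => //; apply: inSN. Qed.

Lemma inS_bas S t : S t -> inS S (bas t).
Proof.
by move=> St u; rewrite cf_bas; case: asboolP => [<-|] //; rewrite eqxx.
Qed.

Lemma sub_inS S S' z : (forall t, S t -> S' t) -> inS S z -> inS S' z.
Proof. by move=> H Hz t /Hz /H. Qed.

Lemma inSI S S' z : inS S z -> inS S' z -> inS (fun t => S t /\ S' t) z.
Proof. by move=> H1 H2 t n0; split; [exact: H1|exact: H2]. Qed.

Lemma inS_ind S (P : fm T -> Prop) :
  P 0 -> (forall x y, P x -> P y -> P (x + y)) ->
  (forall a t, S t -> P (a *: bas t)) -> forall z, inS S z -> P z.
Proof.
by move=> P0 PD PZ z Hz; apply: fm_ind => // a t /Hz; exact: PZ.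
Qed.

Lemma inSNone z : inS (fun _ => False) z -> z = 0.
Proof. by move: z; apply: inS_ind => // x y -> ->; rewrite addr0. Qed.

Lemma inS1 t z : inS (eq^~ t) z -> exists c, z = c *: bas t.
Proof.
move: z; apply: inS_ind => [|x y [c ->] [c' ->]|a u ->].
- by exists 0; rewrite scale0r.
- by exists (c + c'); rewrite scalerDl.
- by exists a.
Qed.

Lemma inST z : inS (fun _ => True) z.
Proof. by []. Qed.

Lemma eq_lin_on S (V : lmodType F) (f g : {linear fm T -> V}) z :
  (forall t, S t -> f (bas t) = g (bas t)) -> inS S z -> f z = g z.
Proof.
move=> H; apply: (inS_ind (P := fun z => f z = g z)).
- by rewrite !linear0.
- by move=> x y Hx Hy; rewrite !linearD Hx Hy.
- by move=> a t St; rewrite !linearZ /= H.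
Qed.

End Support.

Lemma inS_linear (T : Type) (S : T -> Prop) (T' : Type) (S' : T' -> Prop) (f : {linear fm T -> fm T'}) z :
  (forall t, S t -> inS S' (f (bas t))) -> inS S z -> inS S' (f z).
Proof.
move=> H; apply: (inS_ind (P := fun z => inS S' (f z))).
- by rewrite linear0; exact: inS0.
- by move=> x y Hx Hy; rewrite linearD; exact: inSD.
- by move=> a t St; rewrite linearZ; apply: inSZ; exact: H.
Qed.

Section Restriction.
Variables (T : Type).
Implicit Types (S : T -> Prop) (z : fm T).

Definition res S : fm T -> fm T := lin (fun t => if `[< S t >] then bas t else 0).

HB.instance Definition _ S := GRing.Linear.on (res S).

Lemma res_in S z : inS S (res S z).
Proof.
apply: (inS_linear (S := fun _ => True) (f := res S)) => // t _.
rewrite /= /res lin_bas; case: asboolP => St.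
  exact: inS_bas.
exact: inS0.
Qed.

Lemma res_id S z : inS S z -> res S z = z.
Proof.
apply: (eq_lin_on (f := res S) (g := idfun)) => t St /=.
by rewrite /res lin_bas asboolT.
Qed.

Lemma res0 S S' z : inS S' z -> (forall t, S' t -> ~ S t) -> res S z = 0.
Proof.
move=> Hz HS; move: z Hz; apply: inS_ind => [|x y Hx Hy|a t St].
- by rewrite linear0.
- by rewrite linearD /= Hx Hy addr0.
- by rewrite /res lin_scaled_bas asboolF ?scaler0 //; exact: HS.
Qed.

Lemma res_sub S S' z : inS S' z -> inS S' (res S z).
Proof.
apply: (inS_linear (f := res S)) => t St.
rewrite /= /res lin_bas; case: asboolP => H.
  exact: inS_bas.
exact: inS0.
Qed.

Lemma inSU S S' z : inS (fun t => S t \/ S' t) z ->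
  exists x y, [/\ inS S x, inS S' y & z = x + y].
Proof.
move=> Hz; exists (res S z), (z - res S z); split; first exact: res_in.
  move: z Hz; apply: inS_ind => [|x y Hx Hy|a t [St|St]].
  - by rewrite linear0 subrr; exact: inS0.
  - by rewrite linearD /= opprD addrACA; exact: inSD.
  - by rewrite linearZ /= res_id ?subrr; [exact: inS0|exact: inS_bas].
  - rewrite linearZ /= -scalerBr; apply: inSZ; apply: inSB;
      [|apply: res_sub]; exact: inS_bas.
by rewrite addrC subrK.
Qed.
End Restriction.

(** * Mapping cones of complexes spanned by sets of basis elements *)

Section Cone.
Variables (P Q : Type).
Variables (dP : {linear fm P -> fm P}) (dQ : {linear fm Q -> fm Q}).
Variable f : {linear fm P -> fm Q}.
Hypothesis dPdP : forall z, dP (dP z) = 0.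
Hypothesis dQdQ : forall z, dQ (dQ z) = 0.
Hypothesis fd : forall z, f (dP z) = dQ (f z).

Definition subcomplex (T : Type) (d : fm T -> fm T) (S : T -> Prop) : Prop :=
  forall z, inS S z -> inS S (d z).

(* Acyclicity of the mapping cone of f : SP -> SQ. *)
Definition qiso (SP : P -> Prop) (SQ : Q -> Prop) : Prop :=
  forall p q, inS SP p -> inS SQ q -> dP p = 0 -> dQ q = f p ->
  exists p' q', [/\ inS SP p', inS SQ q', dP p' = p & q = f p' + dQ q'].

Lemma qiso_ext SP SQ SP' SQ' :
  (forall t, SP t <-> SP' t) -> (forall t, SQ t <-> SQ' t) ->
  qiso SP SQ -> qiso SP' SQ'.
Proof.
move=> HP HQ H p q Hp Hq dp dq.
have [||p' [q' [? ? ? ?]]] := H p q _ _ dp dq.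
- by apply: sub_inS Hp => t /HP.
- by apply: sub_inS Hq => t /HQ.
exists p', q'; split=> //.
- by apply: (sub_inS (S := SP)) => // t /HP.
- by apply: (sub_inS (S := SQ)) => // t /HQ.
Qed.

(* The boundary of a decomposition z = z1 + z2 of a cycle of the cone lies in the
   intersection, is killed there, and correcting z1, z2 makes them cycles. *)
Lemma qiso_union SP1 SP2 SQ1 SQ2 :
  subcomplex dP SP1 -> subcomplex dP SP2 ->
  subcomplex dQ SQ1 -> subcomplex dQ SQ2 ->
  (forall z, inS SP1 z -> inS SQ1 (f z)) -> (forall z, inS SP2 z -> inS SQ2 (f z)) ->
  qiso SP1 SQ1 -> qiso SP2 SQ2 ->
  qiso (fun t => SP1 t /\ SP2 t) (fun t => SQ1 t /\ SQ2 t) ->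
  qiso (fun t => SP1 t \/ SP2 t) (fun t => SQ1 t \/ SQ2 t).
Proof.
move=> cP1 cP2 cQ1 cQ2 f1 f2 H1 H2 H12 p q /inSU[p1 [p2 [Hp1 Hp2 ->]]]
  /inSU[q1 [q2 [Hq1 Hq2 ->]]].
rewrite !linearD => /eqP; rewrite addr_eq0 => /eqP dp dq.
have db : dQ q1 - f p1 = - (dQ q2 - f p2).
  by rewrite opprB; apply/eqP; rewrite subr_eq addrAC [f p2 + _]addrC -dq addrK.
have [||||a' [b' [Ha' Hb' da Eb]]] := H12 (- dP p1) (dQ q1 - f p1).
- apply: inSI; first by apply: inSN; exact: cP1.
  by rewrite dp opprK; exact: cP2.
- apply: inSI; first by apply: inSB; [exact: cQ1|exact: f1].
  by rewrite db; apply: inSN; apply: inSB; [exact: cQ2|exact: f2].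
- by rewrite linearN dPdP oppr0.
- by rewrite linearB dQdQ sub0r linearN fd.
have Ha1 : inS SP1 a' by apply: sub_inS Ha' => t [].
have Ha2 : inS SP2 a' by apply: sub_inS Ha' => t [].
have Hb1 : inS SQ1 b' by apply: sub_inS Hb' => t [].
have Hb2 : inS SQ2 b' by apply: sub_inS Hb' => t [].
have [||||x1 [y1 [Hx1 Hy1 dx1 ey1]]] := H1 (p1 + a') (q1 - b').
- exact: inSD.
- exact: inSB.
- by rewrite linearD da subrr.
- rewrite linearB linearD; apply/eqP; rewrite subr_eq -addrA -Eb addrC.
  by rewrite subrK.
have [||||x2 [y2 [Hx2 Hy2 dx2 ey2]]] := H2 (p2 - a') (q2 + b').
- exact: inSB.
- exact: inSD.
- by rewrite linearB da dp opprK subrr.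
- have E2 : f a' + dQ b' = f p2 - dQ q2 by rewrite -Eb db opprB.
  rewrite linearD linearB; apply/eqP; rewrite eq_sym subr_eq -addrA.
  by rewrite [dQ b' + _]addrC E2 addrC subrK.
exists (x1 + x2), (y1 + y2); split.
- by apply: inSD; [apply: sub_inS Hx1|apply: sub_inS Hx2] => t; [left|right].
- by apply: inSD; [apply: sub_inS Hy1|apply: sub_inS Hy2] => t; [left|right].
- by rewrite linearD dx1 dx2 addrACA subrr addr0.
- by rewrite !linearD addrACA -ey1 -ey2 addrACA addNr addr0.
Qed.

Variable I : Type.
Variables (SP : I -> P -> Prop) (SQ : I -> Q -> Prop).
Hypothesis cP : forall i, subcomplex dP (SP i).
Hypothesis cQ : forall i, subcomplex dQ (SQ i).
Hypothesis fS : forall i z, inS (SP i) z -> inS (SQ i) (f z).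

Definition meetS (T : Type) (S : I -> T -> Prop) (l : list I) (t : T) : Prop :=
  forall i, List.In i l -> S i t.
Definition joinS (T : Type) (S : I -> T -> Prop) (l : list I) (t : T) : Prop :=
  exists i, List.In i l /\ S i t.

Lemma subcomplex_meet (T : Type) (d : {linear fm T -> fm T}) (S : I -> T -> Prop) l :
  (forall i, subcomplex d (S i)) -> subcomplex d (meetS S l).
Proof.
move=> H z Hz t n0 i il; apply: (H i _ _ t n0).
by apply: sub_inS Hz => u; apply.
Qed.

Lemma subcomplex_bas (T : Type) (d : {linear fm T -> fm T}) (S : T -> Prop) :
  (forall t, S t -> inS S (d (bas t))) -> subcomplex d S.
Proof. by move=> H z; exact: inS_linear. Qed.

Lemma subcomplex_join (T : Type) (d : {linear fm T -> fm T}) (S : I -> T -> Prop) l :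
  (forall i, subcomplex d (S i)) -> subcomplex d (joinS S l).
Proof.
move=> H; apply: subcomplex_bas => t [i [il St]].
apply: (sub_inS (S := S i)) => [u Su|]; first by exists i.
by apply: H; exact: inS_bas.
Qed.

Lemma f_meet l z : inS (meetS SP l) z -> inS (meetS SQ l) (f z).
Proof.
move=> Hz t n0 i il; apply: (fS _ n0).
by apply: sub_inS Hz => u; apply.
Qed.

Lemma f_join l z : inS (joinS SP l) z -> inS (joinS SQ l) (f z).
Proof.
apply: inS_linear => t [i [il St]].
apply: (sub_inS (S := SQ i)) => [u Su|]; first by exists i.
by apply: fS; exact: inS_bas.
Qed.

(** Mayer-Vietoris peels off one member at a time; the intersection of a member with the join of the
    others is again a join, of pairwise meets. *)
Lemma qiso_cover D :
  (forall l, l <> nil -> (forall i, List.In i l -> List.In i D) ->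
     qiso (meetS SP l) (meetS SQ l)) ->
  qiso (joinS SP D) (joinS SQ D).
Proof.
move=> H.
(* Meeting everything with a list [l] closes the induction: the intersection arising at [i] is the
   join over [D'] met with [i :: l]. For [l = nil] the meet is everything. *)
suff: forall D' l, (forall i, List.In i (D' ++ l) -> List.In i D) ->
   qiso (fun t => joinS SP D' t /\ meetS SP l t)
        (fun t => joinS SQ D' t /\ meetS SQ l t).
  move=> /(_ D nil); rewrite cats0 => /(_ (fun i iD => iD)).
  by apply: qiso_ext => t; split=> [[]//|h]; split=> // i [].
elim=> [|i D' IH] l Hl.
  move=> p q Hp Hq _ _.
  have -> : p = 0 by apply: inSNone; apply: sub_inS Hp => t [[i []]].
  have -> : q = 0 by apply: inSNone; apply: sub_inS Hq => t [[i []]].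
  by exists 0, 0; rewrite !linear0 addr0; split=> //; exact: inS0.
have subI (T : Type) (d : {linear fm T -> fm T}) S1 S2 :
    subcomplex d S1 -> subcomplex d S2 -> subcomplex d (fun t => S1 t /\ S2 t).
  move=> c1 c2 z Hz; apply: inSI; [apply: c1|apply: c2];
    by apply: sub_inS Hz => t [].
have := @qiso_union (meetS SP (i :: l)) (fun t => joinS SP D' t /\ meetS SP l t)
  (meetS SQ (i :: l)) (fun t => joinS SQ D' t /\ meetS SQ l t).
move=> HH; apply: qiso_ext (HH _ _ _ _ _ _ _ _ _); rewrite {HH}.
- move=> t; split.
    case=> [Ht|[[j [jD Sj]] Ht]]; last by split=> //; exists j; split=> //; right.
    by split=> [|j jl]; [exists i; split; [left|apply: Ht; left]|apply: Ht; right].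
  move=> [[j [[<-|jD] Sj]] Ht]; last by right; split=> //; exists j.
  by left=> k [<-|kl] //; exact: Ht.
- move=> t; split.
    case=> [Ht|[[j [jD Sj]] Ht]]; last by split=> //; exists j; split=> //; right.
    by split=> [|j jl]; [exists i; split; [left|apply: Ht; left]|apply: Ht; right].
  move=> [[j [[<-|jD] Sj]] Ht]; last by right; split=> //; exists j.
  by left=> k [<-|kl] //; exact: Ht.
- exact: subcomplex_meet.
- by apply: subI; [exact: subcomplex_join|exact: subcomplex_meet].
- exact: subcomplex_meet.
- by apply: subI; [exact: subcomplex_join|exact: subcomplex_meet].
- exact: f_meet.
- move=> z Hz; apply: inSI; [apply: f_join|apply: f_meet];
    by apply: sub_inS Hz => t [].
- apply: H => // j [<-|jl]; apply: Hl; first by left.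
  by right; apply: List.in_or_app; right.
- by apply: IH => j jl; apply: Hl; right.
- have Hil : forall j, List.In j (D' ++ i :: l) -> List.In j D.
    move=> j /(@List.in_app_or _ _ _ _)[jD|[<-|jl]]; apply: Hl.
    + by right; apply: List.in_or_app; left.
    + by left.
    + by right; apply: List.in_or_app; right.
  apply: qiso_ext (IH _ Hil) => t.
  + split=> [[Hj Hm]|[Hm [Hj _]]].
      by split=> [k kl|]; [apply: Hm|split=> // k kl; apply: Hm; right].
    by split.
  + split=> [[Hj Hm]|[Hm [Hj _]]].
      by split=> [k kl|]; [apply: Hm|split=> // k kl; apply: Hm; right].
    by split.
Qed.

(* [o] is the empty simplex: relative cycles (d q = c o) of augmented complexes
   are the cycles of the unaugmented ones. *)
Variables (oP : P) (oQ : Q).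
Hypothesis f_o : f (bas oP) = bas oQ.
Hypothesis d_o : dP (bas oP) = 0.

(** The pair [(c *: bas oP, q)] is a cycle of the cone; that it bounds is surjectivity on relative
    cycles. *)
Lemma qiso_surj SP' SQ' c q : qiso SP' SQ' -> SP' oP -> inS SQ' q ->
  dQ q = c *: bas oQ ->
  exists p q', [/\ inS SP' p, inS SQ' q', dP p = c *: bas oP & q = f p + dQ q'].
Proof.
move=> H So Hq dq.
apply: (H (c *: bas oP) q) => //.
- by apply: inSZ; exact: inS_bas.
- by rewrite linearZ /= d_o scaler0.
- by rewrite linearZ /= f_o.
Qed.

(** The coefficient of [oQ] in [f (dP p)] is [c], while [f (dP p) = dQ (dQ q) = 0]; so [p] is a true
    cycle and [(p, q)] a cycle of the cone. *)
Lemma qiso_inj SP' SQ' c p q : qiso SP' SQ' -> inS SP' p -> inS SQ' q ->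
  dP p = c *: bas oP -> dQ q = f p -> exists2 p', inS SP' p' & dP p' = p.
Proof.
move=> H Hp Hq dp dq.
have dp0 : dP p = 0.
  have : f (dP p) = 0 by rewrite fd -dq dQdQ.
  rewrite dp linearZ /= f_o => /(congr1 (cf oQ)).
  by rewrite cfZ cf0 cf_bas asboolT // mulr1 => ->; rewrite scale0r.
by have [p' [q' [? _ ? _]]] := H p q Hp Hq dp0 dq; exists p'.
Qed.
End Cone.
End FreeModule.

(** * Tuple complexes and subdivision *)

Definition allin (Y : Type) (U : Y -> Prop) (s : list Y) : Prop :=
  forall x, List.In x s -> U x.

Lemma allin_cons (Y : Type) (U : Y -> Prop) a s :
  U a -> allin U s -> allin U (a :: s).
Proof. by move=> Ua Us x [<-|/Us]. Qed.

Section Tuples.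
Local Open Scope ring_scope.
Variable F : fieldType.

Definition cone (Y : Type) (a : Y) : fm F (list Y) -> fm F (list Y) :=
  lin (fun s => bas F (a :: s)).
HB.instance Definition _ (Y : Type) (a : Y) := GRing.Linear.on (cone a).

Definition map_tuple (Y Z : Type) (f : Y -> Z) : fm F (list Y) -> fm F (list Z) :=
  lin (fun s => bas F (map f s)).
HB.instance Definition _ (Y Z : Type) (f : Y -> Z) := GRing.Linear.on (map_tuple f).

(** The alternating sum of faces (see [bd_tuple_sum]), written recursively because coning is the
    basic operation here. A one-point tuple has the empty tuple as boundary. *)
Fixpoint bd_tuple (Y : Type) (s : list Y) : fm F (list Y) :=
  if s is a :: s' then bas F s' - cone a (bd_tuple s') else 0.

Definition bdt (Y : Type) : fm F (list Y) -> fm F (list Y) := lin (@bd_tuple Y).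
HB.instance Definition _ (Y : Type) := GRing.Linear.on (@bdt Y).

Section Boundary.
Variable Y : Type.
Implicit Types (s : list Y) (z : fm F (list Y)).

Lemma cone_bas a s : cone a (bas F s) = bas F (a :: s).
Proof. exact: lin_bas. Qed.

Lemma bdt_bas s : bdt (bas F s) = bd_tuple s.
Proof. exact: lin_bas. Qed.

Lemma bdt_cone a z : bdt (cone a z) = z - cone a (bdt z).
Proof.
apply: (fm_ind (P := fun z => bdt (cone a z) = z - cone a (bdt z))).
- by rewrite !linear0 addr0.
- by move=> x y Hx Hy; rewrite !linearD /= Hx Hy ?opprD addrACA.
- by move=> c s _; rewrite !linearZ /= cone_bas !bdt_bas /= ?scalerBr ?scalerN.
Qed.

Lemma bdt_bdt z : bdt (bdt z) = 0.
Proof.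
apply: (fm_ind (P := fun z => bdt (bdt z) = 0)).
- by rewrite !linear0.
- by move=> x y Hx Hy; rewrite !linearD /= Hx Hy addr0.
- move=> c s _; rewrite !linearZ /= bdt_bas.
  suff -> : bdt (bd_tuple s) = 0 by rewrite scaler0.
  elim: s => [|a s IH] /=; first by rewrite linear0.
  by rewrite linearB /= bdt_cone IH linear0 subr0 bdt_bas subrr.
Qed.

Definition face_of s w : Prop :=
  (forall x, List.In x w -> List.In x s) /\ (size w).+1 = size s.

Lemma bd_tuple_face s : inS (face_of s) (bd_tuple s).
Proof.
elim: s => [|a s IH] /=; first exact: inS0.
apply: inSB; first by apply: inS_bas; split=> // x; right.
apply: (inS_linear (f := cone a)) IH => w [sw zw] /=.
rewrite cone_bas; apply: inS_bas; split=> [x|/=]; last by rewrite zw.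
by case=> [<-|/sw]; [left|right].
Qed.

Lemma bd_tuple_sum s :
  bd_tuple s = \sum_(i <- iota 0 (size s)) (-1) ^+ i *: bas F (drop_at i s).
Proof.
elim: s => [|a s IH]; first by rewrite /= big_nil.
have E : drop_at 0 (a :: s) = s by rewrite /drop_at /= drop0.
have -> : iota 0 (size (a :: s)) = 0%N :: map (addn 1) (iota 0 (size s)).
  by rewrite -iotaDl.
rewrite [LHS]/= IH big_cons expr0 scale1r E.
rewrite big_map linear_sum -sumrN; congr (_ + _).
by apply: eq_bigr => i _; rewrite /= linearZ /= cone_bas exprS mulN1r scaleNr.
Qed.

Lemma bdt_in (U : Y -> Prop) : subcomplex (@bdt Y) (allin U).
Proof.
move=> z; apply: inS_linear => s Us; rewrite /= bdt_bas.
by apply: sub_inS (@bd_tuple_face s) => w [sw _] x /sw /Us.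
Qed.

Lemma cone_in (U : Y -> Prop) a z : U a -> inS (allin U) z -> inS (allin U) (cone a z).
Proof.
move=> Ua; apply: inS_linear => s Us; rewrite /= cone_bas.
by apply: inS_bas; exact: allin_cons.
Qed.
End Boundary.

Section MapTuple.
Variables (Y Z : Type) (f : Y -> Z).

Lemma map_tuple_bas s : map_tuple f (bas F s) = bas F (map f s).
Proof. exact: lin_bas. Qed.

Lemma map_tuple_cone a z : map_tuple f (cone a z) = cone (f a) (map_tuple f z).
Proof.
apply: (eq_lin_on (f := map_tuple f \o cone a) (g := cone (f a) \o map_tuple f)
  (S := fun _ => True)) => // s _ /=.
by rewrite cone_bas !map_tuple_bas cone_bas.
Qed.

Lemma map_bd_tuple s : map_tuple f (bd_tuple s) = bd_tuple (map f s).
Proof.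
elim: s => [|a s IH] /=; first by rewrite linear0.
by rewrite linearB /= map_tuple_bas map_tuple_cone IH.
Qed.
End MapTuple.

(* [b] plays the role of the barycentre; the chain homotopy identities hold
   whatever [b] is. *)
Section Subdivision.
Variables (Y : Type) (b : list Y -> Y).
Implicit Types (s : list Y) (z : fm F (list Y)).

(** The recursion runs through a chain of faces, not a subterm, hence the fuel [n]; [sdt] sets it to
    the number of vertices. *)
Fixpoint sdn (n : nat) s : fm F (list Y) :=
  if n is n'.+1 then cone (b s) (lin (sdn n') (bd_tuple s)) else bas F s.

Fixpoint tdn (n : nat) s : fm F (list Y) :=
  if n is n'.+1 then cone (b s) (bas F s - lin (tdn n') (bd_tuple s)) else 0.

Definition sdt : fm F (list Y) -> fm F (list Y) := lin (fun s => sdn (size s) s).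
HB.instance Definition _ := GRing.Linear.on sdt.
Definition tdt : fm F (list Y) -> fm F (list Y) := lin (fun s => tdn (size s) s).
HB.instance Definition _ := GRing.Linear.on tdt.

Lemma sdt_nil : sdt (bas F [::]) = bas F [::].
Proof. exact: lin_bas. Qed.

Lemma tdt_nil : tdt (bas F [::]) = 0.
Proof. exact: lin_bas. Qed.

Lemma sdt_cons a s :
  sdt (bas F (a :: s)) = cone (b (a :: s)) (sdt (bd_tuple (a :: s))).
Proof.
rewrite {1}/sdt lin_bas [LHS]/=; congr (cone _ _).
apply: (eq_lin_on (f := lin (sdn (size s))) (g := sdt)) (@bd_tuple_face _ (a :: s)).
by move=> w [_ [zw]]; rewrite /= /sdt !lin_bas zw.
Qed.

Lemma tdt_cons a s : tdt (bas F (a :: s)) =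
  cone (b (a :: s)) (bas F (a :: s) - tdt (bd_tuple (a :: s))).
Proof.
rewrite {1}/tdt lin_bas [LHS]/=; congr (cone _ (_ - _)).
apply: (eq_lin_on (f := lin (tdn (size s))) (g := tdt)) (@bd_tuple_face _ (a :: s)).
by move=> w [_ [zw]]; rewrite /= /tdt !lin_bas zw.
Qed.

Lemma bdt_sdt z : bdt (sdt z) = sdt (bdt z).
Proof.
apply: (eq_lin_on (f := @bdt Y \o sdt) (g := sdt \o @bdt Y) (S := fun _ => True)) => //.
move=> s _ /=; have [n zs] : exists n, size s = n by exists (size s).
elim: n s zs => [|n IH] [|a s] // zs; first by rewrite sdt_nil bdt_bas /= linear0.
rewrite sdt_cons bdt_cone bdt_bas.
suff -> : bdt (sdt (bd_tuple (a :: s))) = 0 by rewrite linear0 subr0.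
have -> : bdt (sdt (bd_tuple (a :: s))) = sdt (bdt (bd_tuple (a :: s))).
  apply: (eq_lin_on (f := @bdt Y \o sdt) (g := sdt \o @bdt Y)
    (S := face_of (a :: s))); last exact: (@bd_tuple_face _ (a :: s)).
  by move=> w [_ zw]; apply: IH; move: zw; rewrite zs => -[].
by rewrite -(bdt_bas (a :: s)) bdt_bdt linear0.
Qed.

Lemma bdt_tdt z : bdt (tdt z) + tdt (bdt z) + sdt z = z.
Proof.
have ext (S : list Y -> Prop) :
    (forall s, S s -> bdt (tdt (bas F s)) + tdt (bdt (bas F s)) + sdt (bas F s) = bas F s) ->
    forall z, inS S z -> bdt (tdt z) + tdt (bdt z) + sdt z = z.
  move=> H; apply: inS_ind.
  - by rewrite !linear0 !addr0.
  - move=> x y Hx Hy; rewrite !linearD /= -[in RHS]Hx -[in RHS]Hy.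
    by rewrite (addrACA (bdt (tdt x))) (addrACA _ _ (sdt x)).
  - by move=> c s Ss; rewrite !linearZ /= -!scalerDr H.
suff H s : bdt (tdt (bas F s)) + tdt (bdt (bas F s)) + sdt (bas F s) = bas F s.
  exact: (ext (fun _ => True) (fun s _ => H s) z (@inST _ _ _)).
have [n zs] : exists n, size s = n by exists (size s).
elim: n s zs => [|n IH] [|a s] // zs.
  by rewrite tdt_nil sdt_nil bdt_bas /= !linear0 !add0r.
rewrite tdt_cons bdt_cone sdt_cons bdt_bas.
set u := bas F (a :: s); set w := bd_tuple (a :: s).
have dw : bdt w = 0 by rewrite /w -bdt_bas bdt_bdt.
have E : w - bdt (tdt w) = sdt w.
  have fw v : face_of (a :: s) v -> bdt (tdt (bas F v)) + tdt (bdt (bas F v))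
      + sdt (bas F v) = bas F v.
    by case=> _ zv; apply: IH; move: zv; rewrite zs => -[].
  have := ext _ fw w (@bd_tuple_face _ (a :: s)).
  by rewrite dw linear0 addr0 => {1}<-; rewrite addrAC subrr add0r.
by rewrite [bdt (_ - _)]linearB /= bdt_bas -/w E addrAC !subrK.
Qed.

(** A tuple in the subdivision of [s] is [b s] followed by one from the subdivision of a face, so a
    relation stable under this step holds along the whole subdivision. *)
Lemma sdt_supp (R : list Y -> list Y -> Prop) :
  R [::] [::] ->
  (forall s s' w, s <> [::] -> face_of s s' -> R s' w -> R s (b s :: w)) ->
  forall s, inS (R s) (sdt (bas F s)).
Proof.
move=> R0 RC s; have [n zs] : exists n, size s = n by exists (size s).
elim: n s zs => [|n IH] [|a s] // zs; first by rewrite sdt_nil; apply: inS_bas.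
rewrite sdt_cons; have Hb := @bd_tuple_face _ (a :: s).
move: (bd_tuple (a :: s)) Hb; apply: inS_ind.
- by rewrite !linear0; exact: inS0.
- by move=> x y Hx Hy; rewrite !linearD; exact: inSD.
move=> c w fw; rewrite !linearZ /=; apply: inSZ.
have [_ zw] := fw; move: zw; rewrite zs => -[/IH].
apply: (inS_linear (f := cone (b (a :: s)))) => t Rt /=.
by rewrite cone_bas; apply: inS_bas; exact: RC fw Rt.
Qed.

Lemma tdt_supp (U : Y -> Prop) :
  (forall s, s <> [::] -> allin U s -> U (b s)) ->
  forall s, allin U s -> inS (allin U) (tdt (bas F s)).
Proof.
move=> HU s; have [n zs] : exists n, size s = n by exists (size s).
elim: n s zs => [|n IH] [|a s] // zs Us; first by rewrite tdt_nil; exact: inS0.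
rewrite tdt_cons; apply: cone_in; first exact: HU.
apply: inSB; first exact: inS_bas.
apply: (inS_linear (f := tdt)) (@bd_tuple_face _ (a :: s)) => w [sw zw] /=.
by apply: IH; [move: zw; rewrite zs => -[]|move=> x /sw /Us].
Qed.
End Subdivision.

Lemma map_sdt (Y Z : Type) (b : list Y -> Y) (b' : list Z -> Z) (f : Y -> Z) z :
  (forall s, f (b s) = b' (map f s)) -> map_tuple f (sdt b z) = sdt b' (map_tuple f z).
Proof.
move=> H; apply: (eq_lin_on (f := map_tuple f \o sdt b) (g := sdt b' \o map_tuple f)
  (S := fun _ => True)) => //.
move=> s _ /=; have [n zs] : exists n, size s = n by exists (size s).
elim: n s zs => [|n IH] [|a s] // zs.
  by rewrite sdt_nil !map_tuple_bas sdt_nil.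
rewrite map_tuple_bas map_cons !sdt_cons map_tuple_cone H map_cons; congr (cone _ _).
rewrite -[f a :: map f s]/(map f (a :: s)) -map_bd_tuple.
apply: (eq_lin_on (f := map_tuple f \o sdt b) (g := sdt b' \o map_tuple f))
  (@bd_tuple_face _ (a :: s)) => w [_ zw] /=.
by apply: IH; move: zw; rewrite zs => -[].
Qed.

Lemma map_tdt (Y Z : Type) (b : list Y -> Y) (b' : list Z -> Z) (f : Y -> Z) z :
  (forall s, f (b s) = b' (map f s)) -> map_tuple f (tdt b z) = tdt b' (map_tuple f z).
Proof.
move=> H; apply: (eq_lin_on (f := map_tuple f \o tdt b) (g := tdt b' \o map_tuple f)
  (S := fun _ => True)) => //.
move=> s _ /=; have [n zs] : exists n, size s = n by exists (size s).
elim: n s zs => [|n IH] [|a s] // zs.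
  by rewrite tdt_nil map_tuple_bas tdt_nil linear0.
rewrite map_tuple_bas map_cons !tdt_cons map_tuple_cone H map_cons; congr (cone _ _).
rewrite linearB /= map_tuple_bas map_cons; congr (_ - _).
rewrite -[bas F s - _]/(bd_tuple (a :: s)) -[bas F _ - _]/(bd_tuple (map f (a :: s))) -map_bd_tuple.
apply: (eq_lin_on (f := map_tuple f \o tdt b) (g := tdt b' \o map_tuple f))
  (@bd_tuple_face _ (a :: s)) => w [_ zw] /=.
by apply: IH; move: zw; rewrite zs => -[].
Qed.
End Tuples.

(** * Affine simplices *)

Section Points.
Local Open Scope R_scope.

Definition sumr (l : list R) : R := foldr Rplus 0 l.

Fixpoint dot (t : list R) (v : list (list R)) (j : nat) : R :=
  match t, v with
  | a :: t', x :: v' => a * nth 0 x j + dot t' v' j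
  | _, _ => 0
  end.

(** The point with barycentric coordinates [t] relative to the vertices [v], in [n] ambient
    coordinates. *)
Definition comb (n : nat) (t : list R) (v : list (list R)) : list R :=
  mkseq (dot t v) n.

(* Indexed by the number of vertices: [in_Delta k] is [simplex k.+1], and
   [simplex 0] is empty. *)
Definition simplex (n : nat) (t : list R) : Prop :=
  size t = n /\ (forall a, List.In a t -> 0 <= a) /\ sumr t = 1.

Lemma size_comb n t v : size (comb n t v) = n.
Proof. exact: size_mkseq. Qed.

Lemma nth_comb n t v j : (j < n)%N -> nth 0 (comb n t v) j = dot t v j.
Proof. exact: nth_mkseq. Qed.

Lemma mkseqS (T : Type) (f : nat -> T) n :
  mkseq f n.+1 = f 0%N :: mkseq (fun i => f i.+1) n.
Proof. by rewrite /mkseq /= (iotaDl 1 0) -map_comp. Qed.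

Lemma In_nth (T : Type) (d : T) (l : list T) x :
  List.In x l -> exists2 i, (i < size l)%N & nth d l i = x.
Proof.
elim: l => [|a l IH] //= [<-|/IH[i il <-]]; first by exists 0%N.
by exists i.+1.
Qed.

Lemma nth_In (T : Type) (d : T) (l : list T) i :
  (i < size l)%N -> List.In (nth d l i) l.
Proof.
elim: l i => [|a l IH] [|i] //= il; first by left.
by right; exact: IH.
Qed.

Lemma In_map (T U : Type) (f : T -> U) (l : list T) y :
  List.In y (map f l) -> exists2 x, List.In x l & f x = y.
Proof. by elim: l => [|a l IH] //= [<-|/IH[x xl <-]]; [exists a; [left|]|exists x; [right|]]. Qed.

Lemma map_In (T U : Type) (f : T -> U) (l : list T) x :
  List.In x l -> List.In (f x) (map f l).
Proof. by elim: l => [|a l IH] //= [<-|/IH]; [left|right]. Qed.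

Lemma eq_map_In (T U : Type) (f g : T -> U) (l : list T) :
  (forall x, List.In x l -> f x = g x) -> map f l = map g l.
Proof.
elim: l => [|a l IH] //= H; rewrite H; last by left.
by rewrite IH // => x xl; apply: H; right.
Qed.

Lemma dot_mkseq_lin a (f g : nat -> R) n v j :
  dot (mkseq (fun i => a * f i + g i) n) v j =
  a * dot (mkseq f n) v j + dot (mkseq g n) v j.
Proof.
elim: n f g v => [|n IH] f g v; first by rewrite /=; lra.
rewrite !mkseqS; case: v => [|x v] /=; first by lra.
by rewrite IH; lra.
Qed.

Lemma dot_mkseq0 n v j : dot (mkseq (fun _ => 0) n) v j = 0.
Proof.
elim: n v => [|n IH] v //; rewrite mkseqS; case: v => [|x v] //=.
by rewrite IH; lra.
Qed.

(** Pads or truncates the coefficients to the number of vertices, the form to which [dot_mkseq_lin]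
    applies. *)
Lemma dot_nth p v j : dot p v j = dot (mkseq (nth 0 p) (size v)) v j.
Proof.
elim: v p => [|x v IH] p; first by case: p.
rewrite [size _]/= mkseqS; case: p => [|a p] /=; last by rewrite -IH.
by rewrite dot_mkseq0; lra.
Qed.

Lemma comb_comb N n t w v : size v = n ->
  comb N (comb n t w) v = comb N t (map (fun p => comb N p v) w).
Proof.
move=> <-; rewrite {1 2}/comb /mkseq; apply: eq_map_In => j jN.
have {jN} jN : (j < N)%N.
  have [i] := In_nth 0%N jN; rewrite size_iota => iN; rewrite nth_iota // => <-.
  by [].
elim: t w => [|a t IH] [|p w] /=.
- exact: dot_mkseq0.
- exact: dot_mkseq0.
- exact: dot_mkseq0.
by rewrite dot_mkseq_lin IH nth_comb // [dot p v j]dot_nth.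
Qed.

Definition unitv (n i : nat) : list R := mkseq (fun j => if i == j then 1 else 0) n.
Definition verts (n : nat) : list (list R) := mkseq (unitv n) n.

Lemma size_unitv n i : size (unitv n i) = n. Proof. exact: size_mkseq. Qed.
Lemma size_verts n : size (verts n) = n. Proof. exact: size_mkseq. Qed.

Lemma nth_verts n i : (i < n)%N -> nth [::] (verts n) i = unitv n i.
Proof. exact: nth_mkseq. Qed.

Lemma dot_unitv n i v j : (i < n)%N -> size v = n ->
  dot (unitv n i) v j = nth 0 (nth [::] v i) j.
Proof.
rewrite /unitv; elim: n i v => [|n IH] i [|x v] // lin [zv]; rewrite mkseqS /=.
case: i lin => [|i] lin.
  have -> : mkseq (fun j => if 0%N == j.+1 then 1 else 0) n = mkseq (fun _ => 0) n by [].
  by rewrite dot_mkseq0 /=; lra.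
rewrite -[RHS]/(nth 0 (nth [::] v i) j) -IH //.
have -> : mkseq (fun j0 => if i.+1 == j0.+1 then 1 else 0) n =
  mkseq (fun j0 => if i == j0 then 1 else 0) n by apply: eq_mkseq => k; rewrite eqSS.
by rewrite /=; lra.
Qed.

Lemma comb_unitv N n i v : (i < n)%N -> size v = n -> size (nth [::] v i) = N ->
  comb N (unitv n i) v = nth [::] v i.
Proof.
move=> lin zv zN; apply: (@eq_from_nth _ 0); first by rewrite size_comb.
by move=> j; rewrite size_comb => jN; rewrite nth_comb // dot_unitv.
Qed.

Lemma map_comb_verts N v : (forall x, List.In x v -> size x = N) ->
  map (fun p => comb N p v) (verts (size v)) = v.
Proof.
move=> H; apply: (@eq_from_nth _ [::]); first by rewrite size_map size_verts.
move=> i; rewrite size_map size_verts => iv.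
rewrite (nth_map [::]) ?size_verts // nth_verts // comb_unitv //.
by apply: H; exact: nth_In.
Qed.

Lemma sumr_mkseq_lin a (f g : nat -> R) n :
  sumr (mkseq (fun i => a * f i + g i) n) = a * sumr (mkseq f n) + sumr (mkseq g n).
Proof.
elim: n f g => [|n IH] f g; first by rewrite /sumr /=; lra.
by rewrite !mkseqS /sumr /= -!/(sumr _) IH; lra.
Qed.

Lemma sumr_mkseq0 n : sumr (mkseq (fun _ => 0) n) = 0.
Proof. by elim: n => [|n IH] //; rewrite mkseqS /sumr /= -/(sumr _) IH; lra. Qed.

Lemma sumr_comb N t v : size t = size v -> (forall x, List.In x v -> simplex N x) ->
  sumr (comb N t v) = sumr t.
Proof.
rewrite /comb; elim: t v => [|a t IH] [|x v] //= => [_ _|[zt] H].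
  exact: sumr_mkseq0.
rewrite sumr_mkseq_lin IH //; last by move=> y yv; apply: H; right.
have [zx [_ sx]] := H x (or_introl erefl).
by rewrite -{1}zx mkseq_nth sx /sumr /= -/(sumr _); lra.
Qed.

Lemma nth_ge0 t i : (forall a, List.In a t -> 0 <= a) -> 0 <= nth 0 t i.
Proof.
move=> H; case: (ltnP i (size t)) => it; first by apply: H; exact: nth_In.
by rewrite nth_default //; lra.
Qed.

Lemma dot_ge0 t v j : (forall a, List.In a t -> 0 <= a) ->
  (forall x, List.In x v -> 0 <= nth 0 x j) -> 0 <= dot t v j.
Proof.
elim: t v => [|a t IH] [|x v] /= Ht Hv; try lra.
have := Rmult_le_pos _ _ (Ht a (or_introl erefl)) (Hv x (or_introl erefl)).
have := IH v (fun b bt => Ht b (or_intror bt)) (fun b bt => Hv b (or_intror bt)).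
lra.
Qed.

Lemma simplex_comb N t v : simplex (size v) t -> allin (simplex N) v ->
  simplex N (comb N t v).
Proof.
move=> [zt [pt st]] Hv; split; first exact: size_comb.
split; last by rewrite sumr_comb.
move=> a /(In_nth 0)[j]; rewrite size_comb => jN; rewrite nth_comb // => <-.
apply: dot_ge0 => // x /Hv[_ [px _]]; exact: nth_ge0.
Qed.

Lemma simplex_unitv n i : (i < n)%N -> simplex n (unitv n i).
Proof.
move=> lin; split; first exact: size_unitv.
split.
  move=> a /(In_nth 0)[j]; rewrite size_unitv => jn; rewrite nth_mkseq // => <-.
  by case: eqP => _; lra.
rewrite /unitv; elim: n i lin => [|n IH] [|i] // lin; rewrite mkseqS /sumr /= -/(sumr _).
  by rewrite sumr_mkseq0; lra.
have -> : mkseq (fun j0 => if i.+1 == j0.+1 then 1 else 0) n =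
  mkseq (fun j0 => if i == j0 then 1 else 0) n by apply: eq_mkseq => k; rewrite eqSS.
by rewrite IH //; lra.
Qed.

Lemma verts_in n : allin (simplex n) (verts n).
Proof.
move=> x /(In_nth [::])[i]; rewrite size_verts => lin; rewrite nth_verts // => <-.
exact: simplex_unitv.
Qed.

Lemma dot_insert i t v j : (i < size v)%N -> (size t).+1 = size v ->
  dot (insert_at i 0 t) v j = dot t (drop_at i v) j.
Proof.
elim: v i t => [|x v IH] [|i] t // iv [zt].
  by rewrite /insert_at /drop_at take0 drop0 /= drop0; lra.
case: t zt => [zt|a t zt]; first by move: iv; rewrite [size _]/= -zt.
rewrite -[insert_at _ _ _]/(a :: insert_at i 0 t) -[drop_at _ _]/(x :: drop_at i v) /=.
by rewrite IH.
Qed.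

(** The two descriptions of a face agree: inserting the coordinate 0, as in [Singular], and dropping
    a vertex, as in [bd_tuple_sum]. *)
Lemma comb_insert N i t v : (i < size v)%N -> (size t).+1 = size v ->
  comb N (insert_at i 0 t) v = comb N t (drop_at i v).
Proof. by move=> *; apply: eq_mkseq => j; exact: dot_insert. Qed.

(** The offset [k] is for the induction: removing the first coefficient shifts the remaining unit
    vectors by one. *)
Lemma dot_units n k m t j : (j < n)%N -> size t = m ->
  dot t (mkseq (fun i => unitv n (i + k)) m) j =
  if (k <= j)%N then nth 0 t (j - k) else 0.
Proof.
move=> jn; elim: m k t => [|m IH] k [|a t] // zt.
  by rewrite /= nth_nil; case: ifP.
rewrite mkseqS /= nth_mkseq //.
have -> : mkseq (fun i => unitv n (i.+1 + k)) m = mkseq (fun i => unitv n (i + k.+1)) m.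
  by apply: eq_mkseq => i; rewrite addSnnS.
rewrite IH; last by case: zt.
rewrite add0n; case: (ltngtP k j) => [kj|jk|->].
- by rewrite -[(j - k)%N]prednK ?subn_gt0 // -subnS /=; lra.
- by lra.
- by rewrite subnn /=; lra.
Qed.

Lemma comb_verts n t : size t = n -> comb n t (verts n) = t.
Proof.
move=> zt; apply: (@eq_from_nth _ 0); first by rewrite size_comb.
move=> j; rewrite size_comb => jn; rewrite nth_comb // /verts.
rewrite (_ : mkseq _ _ = mkseq (fun i => unitv n (i + 0)) n).
  by rewrite dot_units // subn0.
by apply: eq_mkseq => i; rewrite addn0.
Qed.

(** Kept homogeneous in [sumr t] because the tail of a point of the simplex may have a smaller
    sum. *)
Lemma dot_close t v j c e : size t = size v -> (forall a, List.In a t -> 0 <= a) ->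
  (forall x, List.In x v -> Rabs (nth 0 x j - c) <= e) ->
  Rabs (dot t v j - sumr t * c) <= sumr t * e.
Proof.
elim: t v => [|a t IH] [|x v] //= => [_ _ _|[zt] Ht Hv].
  by rewrite /sumr /= Rmult_0_l Rminus_diag Rabs_R0; lra.
have Ha := Ht a (or_introl erefl).
have := IH v zt (fun b bt => Ht b (or_intror bt)) (fun b bt => Hv b (or_intror bt)).
have Hx := Hv x (or_introl erefl).
rewrite /sumr /= -/(sumr _) => IH'.
have -> : a * nth 0 x j + dot t v j - (a + sumr t) * c =
  a * (nth 0 x j - c) + (dot t v j - sumr t * c) by ring.
apply: Rle_trans (Rabs_triang _ _) _.
rewrite Rabs_mult (Rabs_pos_eq a) // Rmult_plus_distr_r.
apply: Rplus_le_compat => //; exact: Rmult_le_compat_l.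
Qed.

Lemma comb_close N t v j c e : simplex (size v) t -> (j < N)%N ->
  (forall x, List.In x v -> Rabs (nth 0 x j - c) <= e) ->
  Rabs (nth 0 (comb N t v) j - c) <= e.
Proof.
move=> [zt [pt st]] jN H; have := dot_close zt pt H.
by rewrite st !Rmult_1_l nth_comb.
Qed.

Definition mean (N : nat) (v : list (list R)) : list R :=
  comb N (nseq (size v) (/ INR (size v))) v.

Lemma simplex_nseq n : (0 < n)%N -> simplex n (nseq n (/ INR n)).
Proof.
move=> n0; have In0 : 0 < INR n by apply: lt_0_INR; apply/ltP.
split; first exact: size_nseq.
split.
  move=> a /(In_nth 0)[j]; rewrite size_nseq => jn; rewrite nth_nseq jn => <-.
  by left; exact: Rinv_0_lt_compat.
have -> : forall m c, sumr (nseq m c) = INR m * c.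
  elim=> [|m IH] c; first by rewrite /sumr /=; lra.
  by rewrite S_INR /sumr /= -/(sumr _) IH; lra.
by field; lra.
Qed.

Lemma simplex_mean N v : v <> [::] -> allin (simplex N) v -> simplex N (mean N v).
Proof.
by move=> v0 Hv; apply: simplex_comb => //; apply: simplex_nseq; case: v v0 Hv.
Qed.

Lemma mean_comb N n v w : size v = n ->
  comb N (mean n w) v = mean N (map (fun p => comb N p v) w).
Proof. by move=> zv; rewrite /mean comb_comb // size_map. Qed.

Definition mesh (N : nat) (d : R) (v : list (list R)) : Prop :=
  forall x y j, (j < N)%N -> List.In x v -> List.In y v -> Rabs (nth 0 x j - nth 0 y j) <= d.

(** Among the differences between [x] and the averaged vertices the one with [x] itself vanishes, so
    at most [size v - 1] of the [size v] terms contribute. *)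
Lemma mean_far N v x j d : (j < N)%N -> List.In x v -> mesh N d v ->
  Rabs (nth 0 x j - nth 0 (mean N v) j) <= (1 - / INR (size v)) * d.
Proof.
move=> jN xv Hm; rewrite nth_comb //.
have Hd y : List.In y v -> Rabs (nth 0 x j - nth 0 y j) <= d by move=> yv; exact: Hm.
have d0 : 0 <= d by apply: Rle_trans (Rabs_pos _) (Hd x xv).
have s0 : 0 < INR (size v) by apply: lt_0_INR; apply/ltP; case: v xv {Hm Hd}.
have E : forall c (w : list (list R)), nth 0 x j * (INR (size w) * c) - dot (nseq (size w) c) w j =
    c * sumr (map (fun y => nth 0 x j - nth 0 y j) w).
  move=> c; elim=> [|y w IH]; first by rewrite /sumr /=; ring.
  by rewrite [size _]/= S_INR /sumr /= -/(sumr _) Rmult_plus_distr_l -IH; ring.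
have B : forall w : list (list R), (forall y, List.In y w -> Rabs (nth 0 x j - nth 0 y j) <= d) ->
    Rabs (sumr (map (fun y => nth 0 x j - nth 0 y j) w)) <= INR (size w) * d.
  elim=> [|y w IH] H; first by rewrite /sumr /= Rabs_R0; lra.
  rewrite [size _]/= S_INR /sumr /= -/(sumr _).
  have := IH (fun z zw => H z (or_intror zw)); have := H y (or_introl erefl).
  by have := Rabs_triang (nth 0 x j - nth 0 y j) (sumr (map (fun y => nth 0 x j - nth 0 y j) w)); lra.
(* The summand at [x] is zero: this is the gain of 1 over [B]. *)
have C : forall w : list (list R), (forall y, List.In y w -> Rabs (nth 0 x j - nth 0 y j) <= d) ->
    List.In x w ->
    Rabs (sumr (map (fun y => nth 0 x j - nth 0 y j) w)) <= (INR (size w) - 1) * d.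
  elim=> [|y w IH] H // [->|xw]; rewrite [size _]/= S_INR /sumr /= -/(sumr _).
    have := B w (fun z zw => H z (or_intror zw)).
    by rewrite Rminus_diag Rplus_0_l; lra.
  have := IH (fun z zw => H z (or_intror zw)) xw; have := H y (or_introl erefl).
  by have := Rabs_triang (nth 0 x j - nth 0 y j) (sumr (map (fun y => nth 0 x j - nth 0 y j) w)); lra.
have := E (/ INR (size v)) v; rewrite Rinv_r; last lra.
rewrite Rmult_1_r => ->.
rewrite Rabs_mult Rabs_pos_eq; last by left; exact: Rinv_0_lt_compat.
have -> : (1 - / INR (size v)) * d = / INR (size v) * ((INR (size v) - 1) * d).
  by field; lra.
by apply: Rmult_le_compat_l; [left; exact: Rinv_0_lt_compat|exact: C].
Qed.

Variable F : fieldType.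

(** The mesh clause holds for every [n] bounding the number of vertices: the induction passes to
    faces, whose own factor is smaller, and one [n] must serve them all. The clause on [U] replaces
    convexity by closure under means. *)
Definition subdiv (N : nat) (s w : list (list R)) : Prop :=
  [/\ size w = size s,
      forall U : list R -> Prop, (forall v, v <> [::] -> allin U v -> U (mean N v)) ->
        allin U s -> allin U w &
      forall n d, (0 < n)%N -> (size s <= n)%N -> mesh N d s ->
        mesh N ((1 - / INR n) * d) w].

Lemma sdt_subdiv N s : inS (subdiv N s) (sdt (mean N) (bas F s)).
Proof.
apply: sdt_supp => {s} [|s s' w s0 [ss' zs'] [zw HU Hm]]; first by split=> // n d _ _ _ x y j _ [].
have HU' (U : list R -> Prop) : (forall v, v <> [::] -> allin U v -> U (mean N v)) ->
    allin U s -> allin U w by move=> cU Us; apply: HU => // x /ss' /Us.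
(* The slab of this width around the mean of [s] contains the vertices of [s] by [mean_far] and is
   convex, so it contains every vertex of [w]. *)
have Hmean n d y j : (0 < n)%N -> (size s <= n)%N -> mesh N d s -> (j < N)%N ->
    List.In y w -> Rabs (nth 0 y j - nth 0 (mean N s) j) <= (1 - / INR n) * d.
  move=> n0 sn ms jN; apply: (HU' (fun y => Rabs (nth 0 y j - _) <= _)).
    move=> v v0 Hv; apply: comb_close => //; apply: simplex_nseq.
    by case: v v0 {Hv}.
  move=> x xs; apply: Rle_trans (mean_far jN xs ms) _.
  have d0 : 0 <= d by apply: Rle_trans (Rabs_pos _) (ms x x j jN xs xs).
  apply: Rmult_le_compat_r => //; apply: Rplus_le_compat_l; apply: Ropp_le_contravar.
  apply: Rinv_le_contravar; last by apply: le_INR; apply/leP.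
  by apply: lt_0_INR; apply/ltP; case: s xs {s0 ss' zs' HU' sn ms}.
split; first by rewrite /= zw.
  move=> U cU Us; apply: allin_cons; first exact: cU.
  exact: HU'.
move=> n d n0 sn ms x y j jN [<-|xw] [<-|yw].
- rewrite Rminus_diag Rabs_R0.
  have [x0 x0s] : exists x0, List.In x0 s by case: s s0 {ss' zs' HU' Hmean sn ms} => // a s _; exists a; left.
  have d0 : 0 <= d by apply: Rle_trans (Rabs_pos _) (ms x0 x0 j jN x0s x0s).
  apply: Rmult_le_pos => //.
  have q4 : / INR n <= 1.
    by rewrite -Rinv_1; apply: Rinv_le_contravar; [lra|apply: (le_INR 1); apply/leP].
  by lra.
- by rewrite Rabs_minus_sym; exact: Hmean.
- exact: Hmean.
- apply: (Hm n d) => //; first by rewrite -zs' in sn; exact: ltnW.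
  by move=> a b k kN /ss' aw /ss' bw; exact: ms.
Qed.

Lemma mesh_verts n : mesh n 1 (verts n).
Proof.
move=> x y j jn /verts_in[_ [px sx]] /verts_in[_ [py sy]].
have B t : (forall a, List.In a t -> 0 <= a) -> sumr t = 1 -> 0 <= nth 0 t j <= 1.
  move=> pt <-; split; first exact: nth_ge0.
  elim: t j {jn} pt => [|a t IH] [|j] pt; rewrite /sumr /= -?/(sumr _); try lra.
  - have : 0 <= sumr t; last lra.
    elim: t {IH} pt => [|b t IH] pt; rewrite /sumr /= -?/(sumr _); first lra.
    have := pt b (or_intror (or_introl erefl)).
    suff: 0 <= sumr t by lra.
    by apply: IH => c [<-|ct]; apply: pt; [left|right; right].
  - have := IH j (fun b bt => pt b (or_intror bt)); have := pt a (or_introl erefl).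
    by lra.
by have := B _ px sx; have := B _ py sy; move=> *; apply: Rabs_le; lra.
Qed.
End Points.

(** * Compactness of the simplex *)

Section SimplexCompact.
Local Open Scope R_scope.

Fixpoint list_of_Tn n : Compactness.Tn n R -> list R :=
  match n return Compactness.Tn n R -> list R with
  | 0 => fun _ => [::]
  | n'.+1 => fun x => x.1 :: list_of_Tn x.2
  end.

Fixpoint Tn_of_list n (l : list R) : Compactness.Tn n R :=
  match n return Compactness.Tn n R with
  | 0 => tt
  | n'.+1 => (nth 0 l 0, Tn_of_list n' (behead l))
  end.

Fixpoint const_Tn n (c : R) : Compactness.Tn n R :=
  match n return Compactness.Tn n R with
  | 0 => tt
  | n'.+1 => (c, const_Tn n' c)
  end.

Lemma Tn_of_listK n l : size l = n -> list_of_Tn (Tn_of_list n l) = l.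
Proof. by elim: n l => [|n IH] [|a l] //= [zl]; rewrite IH. Qed.

Lemma size_list_of_Tn n (x : Compactness.Tn n R) : size (list_of_Tn x) = n.
Proof. by elim: n x => [|n IH] //= x; rewrite IH. Qed.

Lemma bounded_list n (x : Compactness.Tn n R) :
  Compactness.bounded_n n (const_Tn n 0) (const_Tn n 1) x <->
  (forall a, List.In a (list_of_Tn x) -> 0 <= a <= 1).
Proof.
elim: n x => [|n IH] /=; first by move=> x; split=> // _ a [].
move=> [x y]; rewrite IH /=; split=> [[Hx Hy] a [<-|ay] //|H]; first exact: Hy.
by split=> [|a ay]; apply: H; [left|right].
Qed.

Lemma close_list n d (x y : Compactness.Tn n R) :
  Compactness.close_n n d x y <->
  (forall i, (i < n)%N -> Rabs (nth 0 (list_of_Tn x) i - nth 0 (list_of_Tn y) i) < d).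
Proof.
elim: n x y => [|n IH] //=; move=> [x x'] [y y']; rewrite IH /=.
split=> [[H0 H] [|i] lin //|H]; first exact: H.
by split=> [|i lin]; [exact: (H 0%N)|exact: (H i.+1)].
Qed.

Lemma sumr_close n t s d : size t = n -> size s = n ->
  (forall i, (i < n)%N -> Rabs (nth 0 t i - nth 0 s i) < d) ->
  Rabs (sumr t - sumr s) <= INR n * d.
Proof.
elim: n t s => [|n IH] [|a t] [|b s] // => [_ _ _|[zt] [zs] H].
  by rewrite /sumr /= Rminus_diag Rabs_R0; lra.
rewrite S_INR.
have := IH t s zt zs (fun i lin => H i.+1 lin); have /= := H 0%N isT.
rewrite /sumr /= -!/(sumr _) => H1 H2.
have -> : a + sumr t - (b + sumr s) = (a - b) + (sumr t - sumr s) by ring.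
have := Rabs_triang (a - b) (sumr t - sumr s); lra.
Qed.

Lemma simplex_le1 n t a : simplex n t -> List.In a t -> a <= 1.
Proof.
move=> [_ [pt <-]]; elim: t pt {n} => [|b t IH] pt //= [->|at_].
  have : 0 <= sumr t; last by rewrite /sumr /=; lra.
  have : forall c, List.In c t -> 0 <= c by move=> c ct; apply: pt; right.
  elim: t {IH pt} => [|c t IH] pt; rewrite /sumr /= -?/(sumr _); first lra.
  have := pt c (or_introl erefl).
  by have := IH (fun d dt => pt d (or_intror dt)); lra.
have := IH (fun d dt => pt d (or_intror dt)) at_; have := pt b (or_introl erefl).
by rewrite /sumr /=; lra.
Qed.

(** Compactness in gauge form: [G q d] says that the radius [d] is good at [q]. The simplex is cut
    out of the unit cube by one equation, and [compactness_value] handles the cube. *)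
Lemma simplex_compact n (G : list R -> R -> Prop) :
  (forall q, simplex n q -> exists d, 0 < d /\ G q d) ->
  exists d, 0 < d /\ forall p, simplex n p ->
    exists q e, [/\ simplex n q, G q e, d <= e &
      forall i, (i < n)%N -> Rabs (nth 0 p i - nth 0 q i) < e].
Proof.
move=> HG.
(* A radius that is good on the simplex and separates the other points of the
   cube from it. *)
have Hd (x : Compactness.Tn n R) : exists e : posreal,
    (simplex n (list_of_Tn x) -> G (list_of_Tn x) e) /\
    (sumr (list_of_Tn x) <> 1 -> INR n * e < Rabs (1 - sumr (list_of_Tn x))).
  have [s1|s1] := pselect (simplex n (list_of_Tn x)).
    have [e [e0 He]] := HG _ s1; exists (mkposreal e e0); split=> //.
    by case: s1 => _ [_ ->].
  have [s2|s2] := pselect (sumr (list_of_Tn x) = 1).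
    by exists (mkposreal 1 Rlt_0_1).
  have n0 : 0 < INR n + 1 by have := pos_INR n; lra.
  have a0 : 0 < Rabs (1 - sumr (list_of_Tn x)) by apply: Rabs_pos_lt; lra.
  (* Within radius [e] the coordinate sum moves by at most [INR n * e]; the extra 1 in the
     denominator makes the inequality strict and covers [n = 0]. *)
  exists (mkposreal _ (Rdiv_lt_0_compat _ _ a0 n0)); split=> //= _.
  rewrite /Rdiv -Rmult_assoc (Rmult_comm (INR n)) Rmult_assoc.
  rewrite -[X in _ < X]Rmult_1_r; apply: Rmult_lt_compat_l => //.
  apply: (Rmult_lt_reg_r (INR n + 1)) => //; rewrite Rmult_assoc Rinv_l; last lra.
  by lra.
pose delta x := sval (cid (Hd x)).
have [d Hdd] := Compactness.compactness_value n (const_Tn n 0) (const_Tn n 1) delta.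
exists d; split; first exact: cond_pos.
move=> p Sp; have [zp [pp sp]] := Sp.
have := Hdd (Tn_of_list n p); rewrite bounded_list Tn_of_listK // => /(_ _)/contrapT[].
  by move=> a ap; split; [exact: pp|exact: simplex_le1 Sp ap].
move=> t [/bounded_list Ht [/close_list]]; rewrite Tn_of_listK // => Hc Hle.
have [HG1 HG2] := svalP (cid (Hd t)); rewrite -/(delta t) in HG1 HG2.
(* The ball around [t] contains [p], whose coordinates sum to 1; the radii chosen off the simplex
   then force the same sum for [t]. *)
have St : simplex n (list_of_Tn t).
  split; first exact: size_list_of_Tn.
  split=> [a /Ht[]//|].
  apply: contrapT => /HG2; have := sumr_close zp (size_list_of_Tn t) Hc.
  by rewrite sp; lra.
by exists (list_of_Tn t), (delta t); split=> //; exact: HG1.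
Qed.
End SimplexCompact.

(** * Singular chains *)

Section Singular.
Local Open Scope ring_scope.
Variables (F : fieldType) (X : MetricSpace) (x0 : X).

(* A singular simplex with [n] vertices, made equal to [x0] off the standard simplex
   so that equality of simplices is Leibniz equality. *)
Definition ssimp : Type := (nat * (list R -> X))%type.

Definition snorm (n : nat) (sig : list R -> X) : list R -> X :=
  fun t => if `[< simplex n t >] then sig t else x0.

Lemma snormE n sig t : simplex n t -> snorm n sig t = sig t.
Proof. by move=> St; rewrite /snorm asboolT. Qed.

Lemma eq_snorm n sig sig' :
  (forall t, simplex n t -> sig t = sig' t) -> snorm n sig = snorm n sig'.
Proof. by move=> H; apply: funext => t; rewrite /snorm; case: asboolP => // /H. Qed.

(** [s] composed with the affine map sending the standard vertices to [v]. Boundary, subdivision and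
    homotopy of [s] are images of tuple chains on [verts s.1], so their identities follow from those
    of [bdt], [sdt] and [tdt]. *)
Definition push (s : ssimp) (v : list (list R)) : ssimp :=
  (size v, snorm (size v) (fun t => s.2 (comb s.1 t v))).

Definition pushl (s : ssimp) : fm F (list (list R)) -> fm F ssimp :=
  lin (fun v => bas F (push s v)).
HB.instance Definition _ s := GRing.Linear.on (pushl s).

Definition bds : fm F ssimp -> fm F ssimp :=
  lin (fun s => pushl s (bd_tuple F (verts s.1))).
HB.instance Definition _ := GRing.Linear.on bds.

Definition sds : fm F ssimp -> fm F ssimp :=
  lin (fun s => pushl s (sdt (mean s.1) (bas F (verts s.1)))).
HB.instance Definition _ := GRing.Linear.on sds.

Definition tds : fm F ssimp -> fm F ssimp :=
  lin (fun s => pushl s (tdt (mean s.1) (bas F (verts s.1)))).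
HB.instance Definition _ := GRing.Linear.on tds.

Lemma pushl_bas s v : pushl s (bas F v) = bas F (push s v).
Proof. exact: lin_bas. Qed.

Lemma bds_bas s : bds (bas F s) = pushl s (bd_tuple F (verts s.1)).
Proof. exact: lin_bas. Qed.

Lemma sds_bas s : sds (bas F s) = pushl s (sdt (mean s.1) (bas F (verts s.1))).
Proof. exact: lin_bas. Qed.

Lemma tds_bas s : tds (bas F s) = pushl s (tdt (mean s.1) (bas F (verts s.1))).
Proof. exact: lin_bas. Qed.

Definition normal (s : ssimp) : Prop := snorm s.1 s.2 = s.2.

Lemma push_verts s : normal s -> push s (verts s.1) = s.
Proof.
case: s => n sig; rewrite /normal /push /= size_verts => Hn; congr (_, _).
by rewrite -[RHS]Hn; apply: eq_snorm => t [zt _]; rewrite comb_verts.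
Qed.

Lemma push_push s v w : allin (simplex (size v)) w ->
  push (push s v) w = push s (map (fun p => comb s.1 p v) w).
Proof.
move=> Hw; rewrite /push size_map; congr (_, _); apply: eq_snorm => t St /=.
by rewrite snormE ?comb_comb //; exact: simplex_comb.
Qed.

Lemma pushl_push s v z : inS (allin (simplex (size v))) z ->
  pushl (push s v) z = pushl s (map_tuple (fun p => comb s.1 p v) z).
Proof.
apply: (eq_lin_on (f := pushl (push s v))
  (g := pushl s \o map_tuple (fun p => comb s.1 p v))) => w Hw /=.
by rewrite map_tuple_bas !pushl_bas push_push.
Qed.

Definition dim_ok (n : nat) : list (list R) -> Prop := allin (fun p => size p = n).

Lemma simplex_dim n v : allin (simplex n) v -> dim_ok n v.
Proof. by move=> H x /H[]. Qed.

Lemma bd_verts_in n : inS (allin (simplex n)) (bd_tuple F (verts n)).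
Proof.
rewrite -bdt_bas; apply: bdt_in; apply: inS_bas; exact: verts_in.
Qed.

Lemma bds_pushl s z : inS (dim_ok s.1) z -> bds (pushl s z) = pushl s (bdt z).
Proof.
apply: (eq_lin_on (f := bds \o pushl s) (g := pushl s \o @bdt F _)) => v Hv /=.
rewrite pushl_bas bds_bas pushl_push /=; last exact: bd_verts_in.
by rewrite map_bd_tuple map_comb_verts // bdt_bas.
Qed.

Lemma bds_bds z : bds (bds z) = 0.
Proof.
apply: (fm_ind (P := fun z => bds (bds z) = 0)).
- by rewrite !linear0.
- by move=> x y Hx Hy; rewrite !linearD /= Hx Hy addr0.
move=> c s _; rewrite !linearZ /= bds_bas bds_pushl.
  by rewrite -bdt_bas bdt_bdt linear0 scaler0.
by apply: sub_inS (@bd_verts_in _) => v; exact: simplex_dim.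
Qed.

Lemma sdt_verts_in n : inS (allin (simplex n)) (sdt (mean n) (bas F (verts n))).
Proof.
apply: sub_inS (@sdt_subdiv F n _) => w [_ H _]; apply: H; last exact: verts_in.
exact: simplex_mean.
Qed.

Lemma tdt_verts_in n : inS (allin (simplex n)) (tdt (mean n) (bas F (verts n))).
Proof. apply: tdt_supp; [exact: simplex_mean|exact: verts_in]. Qed.

Lemma sds_pushl s z : inS (dim_ok s.1) z -> sds (pushl s z) = pushl s (sdt (mean s.1) z).
Proof.
apply: (eq_lin_on (f := sds \o pushl s) (g := pushl s \o sdt (mean s.1))) => v Hv /=.
rewrite pushl_bas sds_bas pushl_push /=; last exact: sdt_verts_in.
rewrite (map_sdt (b' := mean s.1)) ?map_tuple_bas ?map_comb_verts //.
by move=> w; rewrite mean_comb.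
Qed.

Lemma tds_pushl s z : inS (dim_ok s.1) z -> tds (pushl s z) = pushl s (tdt (mean s.1) z).
Proof.
apply: (eq_lin_on (f := tds \o pushl s) (g := pushl s \o tdt (mean s.1))) => v Hv /=.
rewrite pushl_bas tds_bas pushl_push /=; last exact: tdt_verts_in.
rewrite (map_tdt (b' := mean s.1)) ?map_tuple_bas ?map_comb_verts //.
by move=> w; rewrite mean_comb.
Qed.

Lemma bds_sds z : bds (sds z) = sds (bds z).
Proof.
apply: (eq_lin_on (f := bds \o sds) (g := sds \o bds) (S := fun _ => True)) => // s _ /=.
rewrite sds_bas bds_pushl; last by apply: sub_inS (@sdt_verts_in _) => v; exact: simplex_dim.
rewrite bds_bas sds_pushl; last by apply: sub_inS (@bd_verts_in _) => v; exact: simplex_dim.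
by rewrite bdt_sdt bdt_bas.
Qed.

Lemma bds_tds z : inS normal z -> bds (tds z) + tds (bds z) + sds z = z.
Proof.
move: z; apply: inS_ind.
- by rewrite !linear0 !addr0.
- move=> x y Hx Hy; rewrite !linearD /= -[in RHS]Hx -[in RHS]Hy.
  by rewrite (addrACA (bds (tds x))) (addrACA _ _ (sds x)).
move=> c s Hs; rewrite !linearZ /= -!scalerDr; congr (_ *: _).
rewrite tds_bas bds_pushl; last by apply: sub_inS (@tdt_verts_in _) => v; exact: simplex_dim.
rewrite bds_bas tds_pushl; last by apply: sub_inS (@bd_verts_in _) => v; exact: simplex_dim.
by rewrite sds_bas -bdt_bas -!linearD bdt_tdt /= pushl_bas push_verts.
Qed.

Definition scont (n : nat) (sig : list R -> X) : Prop :=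
  (forall t, simplex n t -> forall e, 0 < e -> exists del, 0 < del /\
    forall s, simplex n s ->
      (forall i, (i < n)%N -> Rabs (nth 0 t i - nth 0 s i) < del) ->
      mdist (sig t) (sig s) < e)%R.

Definition sing (U : X -> Prop) (s : ssimp) : Prop :=
  [/\ normal s, scont s.1 s.2 & forall t, simplex s.1 t -> U (s.2 t)].

Lemma normal_snorm n sig : normal (n, snorm n sig).
Proof. by apply: eq_snorm => t St; rewrite /= snormE. Qed.

Lemma scont_snorm n sig : scont n sig -> scont n (snorm n sig).
Proof.
move=> H t St e e0; have [d [d0 Hd]] := H t St e e0; exists d; split=> // s Ss.
by rewrite !snormE //; exact: Hd.
Qed.

Lemma dot_lipschitz t s v j d : (0 <= d)%R -> size t = size v -> size s = size v ->
  (forall i, (i < size v)%N -> Rabs (nth 0 t i - nth 0 s i) <= d)%R ->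
  (forall x, List.In x v -> 0 <= nth 0 x j <= 1)%R ->
  (Rabs (dot t v j - dot s v j) <= INR (size v) * d)%R.
Proof.
move=> d0; elim: v t s => [|x v IH] [|a t] [|b s] //.
  by move=> *; rewrite /= Rminus_diag Rabs_R0; lra.
move=> [zt] [zs] H Hv; rewrite [size (x :: v)]/= S_INR.
have := IH t s zt zs (fun i lin => H i.+1 lin) (fun y yv => Hv y (or_intror yv)).
have /= := H 0%N isT; have := Hv x (or_introl erefl).
move=> Hx Hab H2; rewrite /=.
have -> : (a * nth 0 x j + dot t v j - (b * nth 0 x j + dot s v j) =
  (a - b) * nth 0 x j + (dot t v j - dot s v j))%R by ring.
have := Rabs_triang ((a - b) * nth 0%R x j) (dot t v j - dot s v j).
rewrite Rabs_mult (Rabs_pos_eq (nth 0%R x j)); last lra.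
have : (Rabs (a - b) * nth 0 x j <= d * 1)%R.
  by apply: Rmult_le_compat; try lra; exact: Rabs_pos.
lra.
Qed.

Lemma push_sing U s v : sing U s -> allin (simplex s.1) v -> sing U (push s v).
Proof.
move=> [_ Cs Us] Hv; split; first exact: normal_snorm.
  apply: scont_snorm => t St e e0 /=.
  have [d [d0 Hd]] := Cs _ (simplex_comb St Hv) e e0.
  have n0 : (0 < INR (size v) + 1)%R by have := pos_INR (size v); lra.
  (* Each coordinate of [comb] is Lipschitz in the coefficients with constant [size v]; the 1 added
     keeps the bound strict. *)
  exists (d / (INR (size v) + 1))%R; split; first exact: Rdiv_lt_0_compat.
  move=> t' St' Ht; apply: Hd; first exact: simplex_comb.
  move=> i iN; rewrite !nth_comb //.
  have dp : (0 < d / (INR (size v) + 1))%R by exact: Rdiv_lt_0_compat.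
  apply: (Rle_lt_trans _ (INR (size v) * (d / (INR (size v) + 1)))).
    apply: dot_lipschitz; [lra|by case: St|by case: St'| |].
      by move=> j jv; left; exact: Ht.
    move=> x /Hv Sx; have [_ [px _]] := Sx; split; first exact: nth_ge0.
    case: (ltnP i (size x)) => ix; last by rewrite nth_default //; lra.
    apply: (simplex_le1 Sx); exact: nth_In.
  have : (d = (INR (size v) + 1) * (d / (INR (size v) + 1)))%R by field; lra.
  by lra.
move=> t St; rewrite /= snormE //; apply: Us; exact: simplex_comb.
Qed.

Lemma sing_normal U s : sing U s -> normal s. Proof. by case. Qed.

(** The closure property that makes the span of [S] invariant under boundary, subdivision and
    homotopy at once. *)
Definition stable (S : ssimp -> Prop) : Prop :=
  (forall s, S s -> normal s) /\
  (forall s v, S s -> allin (simplex s.1) v -> S (push s v)).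

Lemma stable_sing U : stable (sing U).
Proof. by split=> [s []|s v] //; exact: push_sing. Qed.

Lemma stable_join (I : Type) (S : I -> ssimp -> Prop) D :
  (forall i, stable (S i)) -> stable (joinS S D).
Proof.
move=> H; split=> [s [i [iD /(proj1 (H i))]]|s v [i [iD Ss]] Hv] //.
by exists i; split=> //; apply: (proj2 (H i)).
Qed.

Lemma pushl_in S s z : stable S -> S s -> inS (allin (simplex s.1)) z -> inS S (pushl s z).
Proof.
move=> [_ H] Ss; apply: inS_linear => v Hv; rewrite /= pushl_bas.
by apply: inS_bas; exact: H.
Qed.

Lemma bds_in S : stable S -> subcomplex bds S.
Proof.
move=> H z; apply: inS_linear => s Ss; rewrite /= bds_bas.
by apply: pushl_in => //; exact: bd_verts_in.
Qed.

Lemma sds_in S z : stable S -> inS S z -> inS S (sds z).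
Proof.
move=> H; apply: inS_linear => s Ss; rewrite /= sds_bas.
by apply: pushl_in => //; exact: sdt_verts_in.
Qed.

Lemma tds_in S z : stable S -> inS S z -> inS S (tds z).
Proof.
move=> H; apply: inS_linear => s Ss; rewrite /= tds_bas.
by apply: pushl_in => //; exact: tdt_verts_in.
Qed.
End Singular.

(** * Small simplices and contractible sets *)

Section Small.
Local Open Scope ring_scope.
Variables (F : fieldType) (X : MetricSpace) (x0 : X).
Variable D : list (X -> Prop).
Hypothesis openD : forall U, List.In U D -> is_open U.
Hypothesis coverD : forall x, exists U, List.In U D /\ U x.

(** A Lebesgue number of the cover pulled back along [sig]. *)
Lemma lebesgue n sig : scont n sig ->
  (exists d, 0 < d /\ forall p, simplex n p -> exists U, List.In U D /\
    forall s, simplex n s -> (forall i, (i < n)%N -> Rabs (nth 0 p i - nth 0 s i) < d) ->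
      U (sig s))%R.
Proof.
move=> Cs.
(* The factor 2 leaves room for a triangle inequality: a point within [d] of [p] is within twice the
   radius of the centre whose ball contains [p]. *)
have [|d [d0 Hd]] := @simplex_compact n (fun q d => exists U, List.In U D /\
    forall s, simplex n s -> (forall i, (i < n)%N -> (Rabs (nth 0 q i - nth 0 s i) < 2 * d)%R) ->
      U (sig s)).
  move=> q Sq; have [U [UD Uq]] := coverD (sig q).
  have [e [e0 He]] := openD UD Uq; have [d [d0 Hd]] := Cs q Sq e e0.
  exists (d / 2)%R; split; first lra.
  exists U; split=> // s Ss Hs; apply: He; apply: Hd => // i lin.
  by have := Hs i lin; lra.
exists d; split=> // p Sp; have [q [e [Sq [U [UD HU]] de Hpq]]] := Hd p Sp.
exists U; split=> // s Ss Hs; apply: HU => // i lin.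
have := Hs i lin; have := Hpq i lin; rewrite (Rabs_minus_sym (nth 0%R p i) (nth 0%R q i)) => H1 H2.
have -> : (nth 0 q i - nth 0 s i = (nth 0 q i - nth 0 p i) + (nth 0 p i - nth 0 s i))%R by ring.
by have := Rabs_triang (nth 0%R q i - nth 0%R p i) (nth 0%R p i - nth 0%R s i); lra.
Qed.

Lemma iter_sdt_mesh N m : (0 < N)%N ->
  inS (fun w => [/\ size w = N, allin (simplex N) w & mesh N ((1 - / INR N) ^ m)%R w])
    (iter m (@sdt F _ (mean N)) (bas F (verts N))).
Proof.
move=> N0; elim: m => [|m IH] /=.
  apply: inS_bas; split; [exact: size_verts|exact: verts_in|exact: mesh_verts].
apply: inS_linear IH => w [zw Sw Mw].
apply: sub_inS (@sdt_subdiv F N w) => v [zv Hv Mv]; split.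
- by rewrite zv.
- by apply: Hv => // u; exact: simplex_mean.
- by apply: Mv => //; rewrite zw.
Qed.

(** Iterated subdivision takes place in the standard simplex, where the mesh is measured, and is
    pushed along [s] afterwards. At [m = 0] the push would return [s] only for normal [s]. *)
Lemma iter_sds s m : iter m (@sds F X x0) (bas F s) =
  if m is 0 then bas F s else pushl x0 s (iter m (@sdt F _ (mean s.1)) (bas F (verts s.1))).
Proof.
case: m => // m; elim: m => [|m IH]; first by rewrite /= sds_bas.
rewrite iterS IH sds_pushl //.
have H0 : inS (allin (simplex s.1)) (bas F (verts s.1)).
  by apply: inS_bas; exact: verts_in.
have Hs (z : fm F _) : inS (allin (simplex s.1)) z -> inS (allin (simplex s.1)) (sdt (mean s.1) z).
  apply: (inS_linear (f := sdt (mean s.1))) => v Sv /=.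
  apply: sub_inS (@sdt_subdiv F s.1 v) => w [_ H _]; apply: H => // u.
  exact: simplex_mean.
apply: (sub_inS (S := allin (simplex s.1))) => [v|]; first exact: simplex_dim.
by elim: m.+1 => [|k IHk] //=; exact: Hs.
Qed.

Notation small := (joinS (sing x0) D).

Lemma stable_small : stable x0 small.
Proof. by apply: stable_join => U; exact: stable_sing. Qed.

Lemma simplex_dim0 t : ~ simplex 0 t.
Proof. by case=> /size0nil -> [_]; rewrite /sumr /=; lra. Qed.

Lemma sing_dim0 U s : normal x0 s -> s.1 = 0%N -> sing x0 U s.
Proof.
case: s => n sig; rewrite /= => Hn n0; subst n.
by split=> // t /simplex_dim0.
Qed.

Lemma iter_small s : sing x0 (fun _ => True) s ->
  exists m, inS small (iter m (@sds F X x0) (bas F s)).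
Proof.
move=> Ss; have [Hn Cs _] := Ss.
have [U0 [U0D _]] := coverD x0.
case: (posnP s.1) => [n0|npos].
  exists 0%N; apply: inS_bas; exists U0; split=> //; exact: sing_dim0.
have [d [d0 Hd]] := lebesgue Cs.
have I0 : (0 < INR s.1)%R by apply: lt_0_INR; apply/ltP.
have I1 : (/ INR s.1 <= 1)%R.
  by rewrite -Rinv_1; apply: Rinv_le_contravar; [lra|apply: (le_INR 1); apply/leP].
have I2 : (0 < / INR s.1)%R by exact: Rinv_0_lt_compat.
have [|m Hm] := @pow_lt_1_zero (1 - / INR s.1) _ d d0; first by rewrite Rabs_pos_eq; lra.
have {}Hm := Hm m.+1 (le_S _ _ (le_n m)).
(* A positive number of subdivisions, so that [iter_sds] yields a push. *)
exists m.+1; rewrite iter_sds.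
apply: (inS_linear (f := pushl x0 s)) (@iter_sdt_mesh s.1 m.+1 npos) => v [zv Sv Mv].
rewrite /= pushl_bas; apply: inS_bas.
case: v zv Sv Mv => [zv|p v zv Sv Mv]; first by rewrite -zv in npos.
(* All vertices of [v] lie within the mesh of the first one [p], hence so does their convex hull. *)
have [|U [UD HU]] := Hd p; first by apply: Sv; left.
exists U; split=> //.
have [Hn' Cs' _] := push_sing Ss Sv; split=> // t St; rewrite /= snormE //.
apply: HU; first by apply: simplex_comb.
move=> i lin; rewrite Rabs_minus_sym.
apply: (Rle_lt_trans _ ((1 - / INR s.1) ^ m.+1)%R).
  by apply: comb_close => // x xv; apply: Mv => //; left.
by apply: Rle_lt_trans Hm; exact: Rle_abs.
Qed.

Lemma iter_small_chain (z : fm F _) : inS (sing x0 (fun _ => True)) z ->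
  exists m, inS small (iter m (@sds F X x0) z).
Proof.
have up (y : fm F _) m k : inS small (iter m (@sds F X x0) y) -> inS small (iter (k + m) (@sds F X x0) y).
  move=> H; elim: k => [|k IH] //; rewrite addSn iterS; apply: sds_in => //.
  exact: stable_small.
have itD m (x y : fm F _) : iter m (@sds F X x0) (x + y) = iter m (@sds F X x0) x + iter m (@sds F X x0) y.
  by elim: m => [|m IH] //; rewrite !iterS IH linearD.
have itZ m a (x : fm F _) : iter m (@sds F X x0) (a *: x) = a *: iter m (@sds F X x0) x.
  by elim: m => [|m IH] //; rewrite !iterS IH linearZ.
move: z; apply: inS_ind.
- by exists 0%N; exact: inS0.
- move=> x y [m Hm] [k Hk]; exists (k + m)%N; rewrite itD.
  by apply: inSD; [exact: up|rewrite addnC; exact: up].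
- by move=> a s /iter_small[m Hm]; exists m; rewrite itZ; exact: inSZ.
Qed.

(** Subdividing [z] changes it by the boundary of [tds z] and by [tds (bds z)], which is small
    because [bds z] is; induct on the number of subdivisions. Surjectivity and injectivity of small
    chains on homology both come from this form. *)
Lemma small_simplices (z : fm F _) : inS (sing x0 (fun _ => True)) z -> inS small (bds x0 z) ->
  exists2 w, inS (sing x0 (fun _ => True)) w & inS small (z - bds x0 w).
Proof.
move=> Hz; have [m Hm] := iter_small_chain Hz.
elim: m z Hz Hm => [|m IH] z Hz Hm Hb.
  by exists 0; [exact: inS0|rewrite linear0 subr0].
have ST := @stable_sing X x0 (fun _ => True).
have [|||w Hw Hs] := IH (sds x0 z).
- exact: sds_in.
- by rewrite -iterSr.
- by rewrite bds_sds; apply: sds_in => //; exact: stable_small.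
exists (tds x0 z + w); first by apply: inSD => //; exact: tds_in.
rewrite linearD /= -[X in X - _](@bds_tds F X x0 z); last first.
  by apply: sub_inS Hz => s; exact: sing_normal.
rewrite -(addrA (bds x0 (tds x0 z))) opprD addrACA subrr add0r -addrA.
by apply: inSD => //; apply: tds_in => //; exact: stable_small.
Qed.
End Small.

(** * Acyclicity of the singular chains of a contractible set *)

Section Contractible.
Local Open Scope ring_scope.
Variables (F : fieldType) (X : MetricSpace) (x0 : X) (U : X -> Prop) (a0 : X).
Variable H : R -> X -> X.
Hypothesis HU : (forall t x, 0 <= t <= 1 -> U x -> U (H t x))%R.
Hypothesis H0 : forall x, U x -> H 0%R x = x.
Hypothesis H1 : forall x, U x -> H 1%R x = a0.
Hypothesis Ua0 : U a0.
Hypothesis Hcont : (forall t x, 0 <= t <= 1 -> U x ->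
  forall e, 0 < e -> exists del, 0 < del /\
    forall s y, 0 <= s <= 1 -> U y -> Rabs (t - s) < del -> mdist x y < del ->
      mdist (H t x) (H s y) < e)%R.

Definition rescale (c : R) (l : list R) : list R := map (fun a => a / c)%R l.

(* The join of [s] with the apex [a0] along the contraction. *)
Definition hmap (sig : list R -> X) (t : list R) : X :=
  let t0 := head 0%R t in
  if `[< (t0 < 1)%R >] then H t0 (sig (rescale (1 - t0) (behead t))) else a0.

Definition hsimp (s : ssimp X) : ssimp X := (s.1.+1, snorm x0 s.1.+1 (hmap s.2)).

Lemma simplex_behead n t : simplex n.+1 t ->
  (0 <= head 0 t <= 1)%R /\
  ((head 0 t < 1)%R -> simplex n (rescale (1 - head 0%R t) (behead t))).
Proof.
move=> St; have := St; case: t St => [|a t] St [zt [pt st]] //=.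
have a1 : (a <= 1)%R by apply: (simplex_le1 St); left.
split=> [|al]; first by split=> //; apply: pt; left.
have i0 : (0 < / (1 - a))%R by apply: Rinv_0_lt_compat; lra.
split; first by rewrite size_map; case: zt.
split.
  move=> b /(@In_map _ _ _ _ _)[c ct <-]; apply: Rmult_le_pos; last lra.
  by apply: pt; right.
have -> : sumr (rescale (1 - a) t) = (sumr t / (1 - a))%R.
  elim: t {St zt pt st} => [|b t]; rewrite /sumr /rescale /=; first by field; lra.
  by move=> ->; field; lra.
have -> : (sumr t = 1 - a)%R by move: st; rewrite /sumr /=; lra.
by field; lra.
Qed.

Lemma comb_rescale N c t w : comb N (rescale c t) w = rescale c (comb N t w).
Proof.
rewrite /comb /rescale /mkseq -map_comp; apply: eq_map_In => j _ /=.
elim: t w => [|a t IH] [|x w] /=; try by rewrite /Rdiv; ring.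
by rewrite IH /Rdiv; ring.
Qed.

Lemma dot_cons0 t v j : dot t (map (cons 0%R) v) j.+1 = dot t v j.
Proof. by elim: t v => [|a t IH] [|x v] //=; rewrite IH. Qed.

Lemma dot_cons00 t v : dot t (map (cons 0%R) v) 0 = 0%R.
Proof. by elim: t v => [|a t IH] [|x v] //=; rewrite IH; ring. Qed.

Lemma comb_cons0 N t v : comb N.+1 t (map (cons 0%R) v) = 0%R :: comb N t v.
Proof.
rewrite /comb mkseqS dot_cons00; congr (_ :: _); apply: eq_mkseq => j.
exact: dot_cons0.
Qed.

Lemma comb_apex N a t v :
  comb N.+1 (a :: t) (unitv N.+1 0 :: map (cons 0%R) v) = a :: comb N t v.
Proof.
rewrite /comb mkseqS; congr (_ :: _).
  by rewrite /= dot_cons00; ring.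
rewrite /mkseq; apply: eq_map_In => j /(In_nth 0%N)[i].
rewrite size_iota => iN; rewrite nth_iota // => <-.
rewrite -[LHS]/(a * nth 0 (unitv N.+1 0) (0 + i).+1 + dot t (map (cons 0) v) (0 + i).+1)%R.
by rewrite dot_cons0 nth_mkseq //= Rmult_0_r Rplus_0_l.
Qed.

Lemma verts_cons n : verts n.+1 = unitv n.+1 0 :: map (cons 0%R) (verts n).
Proof.
rewrite /verts mkseqS; congr (_ :: _); rewrite /mkseq -map_comp; apply: eq_map => i.
by rewrite /= /unitv mkseqS.
Qed.

(** On the face opposite the apex the contraction is at time 0, where it is the identity. *)
Lemma push_base s v : sing x0 U s -> allin (simplex s.1) v ->
  push x0 (hsimp s) (map (cons 0%R) v) = push x0 s v.
Proof.
move=> [_ _ Us] Hv; rewrite /push size_map; congr (_, _); apply: eq_snorm => t St /=.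
have Sc := simplex_comb St Hv.
rewrite comb_cons0 snormE.
  rewrite /hmap /= asboolT; last lra.
  rewrite (_ : rescale _ _ = comb s.1 t v) ?H0 //; first exact: Us.
  rewrite /rescale -[RHS]map_id; apply: eq_map => a; field.
have [zc [pc sc]] := Sc; split; first by rewrite /= zc.
split; first by move=> a [<-|/pc] //; lra.
by rewrite /sumr /= -/(sumr _) sc; lra.
Qed.

(** A face through the apex is the join over a face of the base, because rescaling commutes with
    affine combinations. *)
Lemma push_apex s w : sing x0 U s -> allin (simplex s.1) w ->
  push x0 (hsimp s) (unitv s.1.+1 0 :: map (cons 0%R) w) = hsimp (push x0 s w).
Proof.
move=> [_ _ Us] Hw; rewrite /push /hsimp /= size_map; congr (_, _); apply: eq_snorm => t St.
have := simplex_behead St; have [zt _] := St; case: t zt St => // a t zt St /= [a01 Sr].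
rewrite comb_apex snormE.
  rewrite /hmap /=; case: asboolP => // al.
  by rewrite snormE ?comb_rescale //; exact: Sr.
rewrite -comb_apex; apply: simplex_comb; first by rewrite /= size_map.
apply: allin_cons; first exact: simplex_unitv.
move=> p /(@In_map _ _ _ _ _)[q /Hw[zq [pq sq]] <-]; split; first by rewrite /= zq.
split; first by move=> b [<-|/pq] //; lra.
by rewrite /sumr /= -/(sumr _) sq; lra.
Qed.

Definition hl : fm F (ssimp X) -> fm F (ssimp X) := lin (fun s => bas F (hsimp s)).
HB.instance Definition _ := GRing.Linear.on hl.

Lemma bds_hl s : sing x0 U s -> bds x0 (bas F (hsimp s)) = bas F s - hl (bds x0 (bas F s)).
Proof.
move=> Ss; rewrite !bds_bas -[(hsimp s).1]/(s.1.+1) verts_cons.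
rewrite -[bd_tuple F (_ :: _)]/(bas F _ - cone _ (bd_tuple F _)) linearB.
rewrite [X in X - _]pushl_bas push_base //; last exact: verts_in.
rewrite push_verts; last exact: sing_normal Ss.
congr (_ - _); rewrite -map_bd_tuple.
apply: (eq_lin_on (f := pushl x0 (hsimp s) \o cone (unitv s.1.+1 0) \o map_tuple (cons 0%R))
  (g := hl \o pushl x0 s)) (@bd_verts_in F s.1) => w Sw /=.
by rewrite map_tuple_bas cone_bas !pushl_bas /hl lin_bas push_apex.
Qed.

Lemma nth_rescale c l i : nth 0%R (rescale c l) i = (nth 0 l i / c)%R.
Proof.
case: (ltnP i (size l)) => il; first by rewrite (nth_map 0%R).
by rewrite !nth_default ?size_map // /Rdiv Rmult_0_l.
Qed.

(** The difference is [(q (a - b) + (x - y)) / (1 - b)], where the numerator is below [2 d] and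
    [1 - b] is at least [(1 - a) / 2]. *)
Lemma rescale_close a b x q y d eps : (0 <= q <= 1 -> x = q * (1 - a) -> a < 1 -> b < 1 ->
  Rabs (a - b) < d -> Rabs (x - y) < d -> 0 < eps ->
  d <= (1 - a) / 2 -> d <= eps * (1 - a) / 4 ->
  Rabs (q - y / (1 - b)) < eps)%R.
Proof.
move=> Hq -> a1 b1 Hab Hxy e0 d1 d2.
have w0 : (0 < 1 - b)%R by lra.
have wu : ((1 - a) / 2 <= 1 - b)%R by move: Hab; rewrite /Rabs; case: Rcase_abs; lra.
have -> : (q - y / (1 - b) = (q * (a - b) + (q * (1 - a) - y)) * / (1 - b))%R by field; lra.
rewrite Rabs_mult (Rabs_pos_eq (/ (1 - b))); last by left; exact: Rinv_0_lt_compat.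
apply: (Rmult_lt_reg_r (1 - b)) => //; rewrite Rmult_assoc Rinv_l; last lra.
rewrite Rmult_1_r; apply: Rle_lt_trans (Rabs_triang _ _) _.
rewrite Rabs_mult (Rabs_pos_eq q); last lra.
have : (q * Rabs (a - b) <= 1 * d)%R.
  by apply: Rmult_le_compat; try lra; exact: Rabs_pos.
have : (eps * ((1 - a) / 2) <= eps * (1 - b))%R by apply: Rmult_le_compat_l; lra.
by lra.
Qed.

(** Away from the apex the rescaled base point varies continuously. At the apex it has no limit, and
    [H] near time 1 must be close to [a0] uniformly over the base: compactness of the simplex gives
    this. *)
Lemma hmap_cont n sig : scont n sig -> (forall t, simplex n t -> U (sig t)) ->
  scont n.+1 (hmap sig).
Proof.
move=> Cs Us t St e e0.
have [t01 Sr] := simplex_behead St.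
have [t1|t1] := pselect (head 0 t < 1)%R.
  have Sq := Sr t1; set q := rescale _ _ in Sq.
  have [dH [dH0 HdH]] := Hcont t01 (Us _ Sq) e0.
  have [ds [ds0 Hds]] := Cs q Sq dH dH0.
  (* [dH] serves the time variable of [H]; the other two bounds are those of [rescale_close], and
     they keep [s] away from the apex. *)
  pose d := Rmin dH (Rmin ((1 - head 0 t) / 2) (ds * (1 - head 0 t) / 4))%R.
  have d1 : (d <= dH)%R by exact: Rmin_l.
  have d2 : (d <= (1 - head 0 t) / 2)%R by apply: Rle_trans (Rmin_r _ _) (Rmin_l _ _).
  have d3 : (d <= ds * (1 - head 0 t) / 4)%R by apply: Rle_trans (Rmin_r _ _) (Rmin_r _ _).
  exists d; split.
    apply: Rmin_glb_lt => //; apply: Rmin_glb_lt; first lra.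
    by have := Rmult_lt_0_compat _ _ ds0 (Rlt_Rminus _ _ t1); lra.
  move=> s Ss Hs; have [s01 Ssr] := simplex_behead Ss.
  have Hab := Hs 0%N isT; rewrite !nth0 in Hab.
  have s1 : (head 0 s < 1)%R by move: Hab; rewrite /Rabs; case: Rcase_abs; lra.
  rewrite /hmap !asboolT // -/q; apply: HdH => //; first by apply: Us; exact: Ssr.
    by lra.
  apply: Hds; first exact: Ssr.
  move=> i lin; rewrite nth_rescale.
  have Hi := Hs i.+1 lin; rewrite -!nth_behead in Hi.
  apply: (rescale_close (a := head 0%R t) (x := nth 0%R (behead t) i) (d := d)) => //.
    split; first by apply: nth_ge0; case: Sq => _ [].
    have zq : size q = n by case: Sq.
    by apply: (simplex_le1 Sq); apply: nth_In; rewrite zq.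
  by rewrite nth_rescale; field; lra.
have h1 : (head 0 t = 1)%R by lra.
(* A radius good at [q] serves all times near 1 and all base points near [q] together. *)
have [|d [d0 Hd]] := @simplex_compact n (fun q d => forall b p, (0 <= b <= 1)%R ->
    simplex n p -> (Rabs (1 - b) < d)%R ->
    (forall i, (i < n)%N -> (Rabs (nth 0 q i - nth 0 p i) < d)%R) ->
    (mdist a0 (H b (sig p)) < e)%R).
  move=> q Sq; have [|dH [dH0 HdH]] := @Hcont 1%R (sig q) _ (Us _ Sq) e e0; first lra.
  have [ds [ds0 Hds]] := Cs q Sq dH dH0.
  exists (Rmin dH ds); split; first exact: Rmin_glb_lt.
  move=> b p Hb Sp H1b Hqp; rewrite -(H1 (Us _ Sq)); apply: HdH => //; first exact: Us.
    by apply: Rlt_le_trans H1b _; exact: Rmin_l.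
  apply: Hds => // i lin; apply: Rlt_le_trans (Hqp i lin) _; exact: Rmin_r.
exists d; split=> // s Ss Hs; have [s01 Ssr] := simplex_behead Ss.
rewrite {1}/hmap asboolF // /hmap; case: asboolP => s1; last first.
  by rewrite (proj2 (mdist_eq0 a0 a0) erefl).
have [q [e' [Sq HG de Hpq]]] := Hd _ (Ssr s1).
have Hab := Hs 0%N isT; rewrite !nth0 h1 in Hab.
apply: HG => //; [exact: Ssr|lra|].
by move=> i lin; rewrite Rabs_minus_sym; exact: Hpq.
Qed.

Lemma hsimp_sing s : sing x0 U s -> sing x0 U (hsimp s).
Proof.
move=> [_ Cs Us]; split; first exact: normal_snorm.
  by apply: scont_snorm; exact: hmap_cont.
move=> t St; rewrite /= snormE // /hmap; case: asboolP => // t1.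
have [t01 Sr] := simplex_behead St.
by apply: HU => //; apply: Us; exact: Sr.
Qed.

Lemma sing_acyclic (z : fm F _) : inS (sing x0 U) z -> bds x0 z = 0 ->
  exists2 w, inS (sing x0 U) w & bds x0 w = z.
Proof.
move=> Hz dz; exists (hl z).
  apply: (inS_linear (f := hl)) Hz => s Ss; rewrite /= /hl lin_bas.
  by apply: inS_bas; exact: hsimp_sing.
rewrite -[RHS]subr0 -[X in _ - X](linear0 hl) -dz {dz}.
move: z Hz; apply: inS_ind.
- by rewrite !linear0 addr0.
- by move=> x y Hx Hy; rewrite !linearD /= Hx Hy ?opprD addrACA.
- move=> c s Ss; rewrite !linearZ /= [hl (bas F s)]lin_bas bds_hl //.
  by rewrite scalerBr ?scalerN.
Qed.
End Contractible.

(** * Comparison of singular chains and tuples *)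

Section Compare.
Local Open Scope ring_scope.
Variables (F : fieldType) (X : MetricSpace) (x0 : X).

Definition esimp : ssimp X := (0%N, fun _ => x0).

Lemma esimp_normal : normal x0 esimp.
Proof. by apply: funext => t; rewrite /= /snorm; case: ifP. Qed.

Lemma esimp_sing U : sing x0 U esimp.
Proof. by apply: sing_dim0 => //; exact: esimp_normal. Qed.

Lemma esimpE s : normal x0 s -> s.1 = 0%N -> s = esimp.
Proof.
case: s => n sig; rewrite /normal /= => Hn n0; subst n; congr (_, _); rewrite -Hn.
by apply: funext => t; rewrite /snorm asboolF //; exact: simplex_dim0.
Qed.

Lemma bds_esimp : bds x0 (bas F esimp) = 0.
Proof. by rewrite bds_bas linear0. Qed.

Definition vtuple (s : ssimp X) : list X := map s.2 (verts s.1).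

Definition nul : fm F (ssimp X) -> fm F (list X) := lin (fun s => bas F (vtuple s)).
HB.instance Definition _ := GRing.Linear.on nul.

Lemma nul_bas s : nul (bas F s) = bas F (vtuple s).
Proof. exact: lin_bas. Qed.

Lemma nul_pushl s z : inS (allin (simplex s.1)) z ->
  nul (pushl x0 s z) = map_tuple s.2 z.
Proof.
apply: (eq_lin_on (f := nul \o pushl x0 s) (g := map_tuple s.2)) => v Sv /=.
rewrite pushl_bas nul_bas map_tuple_bas; congr bas.
rewrite /vtuple /= -[in RHS](@map_comb_verts s.1 v); last exact: simplex_dim.
rewrite -map_comp; apply: eq_map_In => p /verts_in Sp /=.
by rewrite snormE.
Qed.

Lemma nul_bds z : nul (bds x0 z) = bdt (nul z).
Proof.
apply: (eq_lin_on (f := nul \o bds x0) (g := @bdt F X \o nul) (S := fun _ => True)) => //.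
move=> s _ /=; rewrite bds_bas nul_pushl; last exact: bd_verts_in.
by rewrite map_bd_tuple nul_bas bdt_bas.
Qed.

Lemma nul_in U z : inS (sing x0 U) z -> inS (allin U) (nul z).
Proof.
apply: inS_linear => s [_ _ Us]; rewrite /= nul_bas; apply: inS_bas.
by move=> x /(@In_map _ _ _ _ _)[p /verts_in Sp <-]; exact: Us.
Qed.

Lemma nul_esimp : nul (bas F esimp) = bas F [::].
Proof. exact: nul_bas. Qed.

Lemma acyclic_tuples (Y : Type) (U : Y -> Prop) a (z : fm F (list Y)) :
  U a -> inS (allin U) z -> bdt z = 0 -> inS (allin U) (cone a z) /\ bdt (cone a z) = z.
Proof.
by move=> Ua Hz dz; split; [exact: cone_in|rewrite bdt_cone dz linear0 subr0].
Qed.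

(** In a contractible [U], fill [p] by joins with the apex, then the remaining cycle of tuples by
    coning at [a0]. For empty [U] both complexes are spanned by the empty simplex, which [nul]
    preserves. *)
Lemma nul_qiso_set U : (forall x, ~ U x) \/ contractible U ->
  qiso (bds x0) (@bdt F X) nul (sing x0 U) (allin U).
Proof.
case=> [U0|[a0 [Ua0 [H [HU [H0 [H1 Hc]]]]]]] p q Hp Hq dp dq; last first.
  have [p' Hp' dp'] := sing_acyclic HU H0 H1 Ua0 Hc Hp dp.
  have [] := @acyclic_tuples X U a0 (q - nul p') Ua0.
  - by apply: inSB => //; exact: nul_in.
  - by rewrite linearB /= dq -nul_bds dp' subrr.
  move=> Hc' dc; exists p', (cone a0 (q - nul p')); split=> //.
  by rewrite /= dc addrC subrK.
have [c Ep] : exists c, p = c *: bas F esimp.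
  apply: inS1; apply: sub_inS Hp => -[[|n] sig] [Hn _ Us]; first exact: esimpE.
  by case: (U0 (sig (unitv n.+1 0))); apply: (Us (unitv n.+1 0)); exact: simplex_unitv.
have [b Eq] : exists b, q = b *: bas F [::].
  by apply: inS1; apply: sub_inS Hq => -[|x s] // /(_ x (or_introl erefl)) /U0.
exists (b *: bas F esimp), 0; split.
- by apply: inSZ; apply: inS_bas; exact: esimp_sing.
- exact: inS0.
- have : c *: bas F ([::] : list X) = 0.
    by rewrite -nul_esimp -linearZ -Ep -dq Eq linearZ /= bdt_bas /= scaler0.
  move=> /(congr1 (cf [::])); rewrite cfZ cf0 cf_bas asboolT // mulr1 Ep => ->.
  by rewrite linearZ /= bds_esimp scaler0 scale0r.
- by rewrite linear0 addr0 linearZ /= nul_esimp.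
Qed.

(** Cone both sides at a common point of [A] and [U]; if [U] is empty, only the empty tuple remains
    on either side. *)
Lemma incl_qiso_set (Y : Type) (A U : Y -> Prop) :
  ((exists x, U x) -> exists x, A x /\ U x) ->
  qiso (@bdt F Y) (@bdt F Y) idfun (allin (fun x => A x /\ U x)) (allin U).
Proof.
move=> HA p q Hp Hq dp /= dq.
have [/HA[a [Aa Ua]]|U0] := pselect (exists x, U x).
  have [Hc dc] := @acyclic_tuples Y (fun x => A x /\ U x) a p (conj Aa Ua) Hp dp.
  have Hc' : inS (allin U) (cone a p) by apply: sub_inS Hc => s Hs x /Hs[].
  have [] := @acyclic_tuples Y U a (q - cone a p) Ua.
  - exact: inSB.
  - by rewrite linearB /= dq dc subrr.
  move=> Hd dd; exists (cone a p), (cone a (q - cone a p)); split=> //.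
  by rewrite /= dd addrC subrK.
exists q, 0; split=> //.
- by apply: sub_inS Hq => s Hs x /Hs Ux; case: U0; exists x.
- exact: inS0.
- by rewrite linear0 addr0.
Qed.

Definition inter (T : Type) (l : list (T -> Prop)) (x : T) : Prop :=
  forall U, List.In U l -> U x.

Lemma meet_sing l s : l <> [::] -> sing x0 (inter l) s <-> meetS (sing x0) l s.
Proof.
case: l => // U0 l _; split=> [[Hn Cs Hl] U Ul|H].
  by split=> // t /Hl; apply.
have [Hn Cs _] := H U0 (or_introl erefl); split=> // t St U /H[_ _]; exact.
Qed.

Lemma meet_allin (Y : Type) l (s : list Y) :
  allin (inter l) s <-> meetS (@allin Y) l s.
Proof. by split=> [H U Ul x /H|H x xs U /H]; apply. Qed.

Definition tup (Y : Type) (A U : Y -> Prop) : list Y -> Prop := allin (fun x => A x /\ U x).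

Lemma meet_tup (Y : Type) (A : Y -> Prop) l (s : list Y) : l <> [::] ->
  allin (fun x => A x /\ inter l x) s <-> meetS (tup A) l s.
Proof.
case: l => // U0 l _; split=> [H U Ul x /H[Ax Hx]|H x xs].
  by split=> //; exact: Hx.
by split=> [|U /H /(_ x xs)[]] //; case: (H U0 (or_introl erefl) x xs).
Qed.

Section Cover.
Variable D : list (X -> Prop).
Hypothesis goodD : forall l, l <> [::] -> (forall U, List.In U l -> List.In U D) ->
  (forall x, ~ inter l x) \/ contractible (inter l).

Lemma nul_qiso : qiso (bds x0) (@bdt F X) nul (joinS (sing x0) D) (joinS (@allin X) D).
Proof.
apply: qiso_cover => [z|z|z|U|U|U|l l0 lD].
- exact: bds_bds.
- exact: bdt_bdt.
- exact: nul_bds.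
- by apply: bds_in; exact: stable_sing.
- exact: bdt_in.
- exact: nul_in.
apply: qiso_ext (nul_qiso_set (goodD l0 lD)) => s; first exact: meet_sing.
exact: meet_allin.
Qed.

Variable A : X -> Prop.
Hypothesis hitA : forall l, l <> [::] -> (forall U, List.In U l -> List.In U D) ->
  (exists x, inter l x) -> exists x, A x /\ inter l x.

Lemma incl_qiso : qiso (@bdt F X) (@bdt F X) idfun (joinS (tup A) D) (joinS (@allin X) D).
Proof.
apply: qiso_cover => [z|z|z|U|U|U z|l l0 lD].
- exact: bdt_bdt.
- exact: bdt_bdt.
- by [].
- exact: bdt_in.
- exact: bdt_in.
- by apply: sub_inS => s Hs x /Hs[].
apply: qiso_ext (incl_qiso_set (hitA l0 lD)) => s; first exact: meet_tup.
exact: meet_allin.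
Qed.
End Cover.

Lemma sub_join (T I : Type) (S : I -> T -> Prop) (D D' : list I) t :
  (forall i, List.In i D -> List.In i D') -> joinS S D t -> joinS S D' t.
Proof. by move=> H [i [/H iD St]]; exists i. Qed.

Lemma nul_join D z : inS (joinS (sing x0) D) z -> inS (joinS (@allin X) D) (nul z).
Proof. apply: (f_join (f := nul)) => U y; exact: nul_in. Qed.

Section Small.
Variable E : list (X -> Prop).
Hypothesis openE : forall U, List.In U E -> is_open U.
Hypothesis coverE : forall x, exists U, List.In U E /\ U x.

Lemma small_esimp : joinS (sing x0) E esimp.
Proof. by have [U [UD _]] := coverE x0; exists U; split=> //; exact: esimp_sing. Qed.

Lemma small_surj c (z : fm F _) : inS (sing x0 (fun _ => True)) z ->
  bds x0 z = c *: bas F esimp ->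
  exists p w, [/\ inS (joinS (sing x0) E) p, inS (sing x0 (fun _ => True)) w,
    bds x0 p = c *: bas F esimp & z = p + bds x0 w].
Proof.
move=> Hz dz; have [|w Hw Hs] := small_simplices openE coverE Hz.
  by rewrite dz; apply: inSZ; apply: inS_bas; exact: small_esimp.
by exists (z - bds x0 w), w; split=> //; rewrite ?linearB /= ?bds_bds ?subr0 ?subrK.
Qed.

Lemma small_inj (w : fm F _) :
  inS (sing x0 (fun _ => True)) w -> inS (joinS (sing x0) E) (bds x0 w) ->
  exists2 w', inS (joinS (sing x0) E) w' & bds x0 w' = bds x0 w.
Proof.
move=> Hw Hb; have [w1 _ Hs] := small_simplices openE coverE Hw Hb.
by exists (w - bds x0 w1) => //; rewrite linearB /= bds_bds subr0.
Qed.
End Small.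

Lemma small_all E (z : fm F _) : inS (joinS (sing x0) E) z ->
  inS (sing x0 (fun _ => True)) z.
Proof. by apply: sub_inS => s [U [_ [Hn Cs Us]]]; split. Qed.

(** * Independence of the finite cover *)

Section Refine.
Variables D D' : list (X -> Prop).
Hypothesis DD' : forall U, List.In U D -> List.In U D'.
Hypothesis openD' : forall U, List.In U D' -> is_open U.
Hypothesis coverD : forall x, exists U, List.In U D /\ U x.
Hypothesis goodD' : forall l, l <> [::] -> (forall U, List.In U l -> List.In U D') ->
  (forall x, ~ inter l x) \/ contractible (inter l).

Let goodD l (l0 : l <> [::]) (lD : forall U, List.In U l -> List.In U D) :
  (forall x, ~ inter l x) \/ contractible (inter l) :=
  goodD' l0 (fun U Ul => DD' (lD U Ul)).
Let openD U (UD : List.In U D) : is_open U := openD' (DD' UD).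
Let coverD' x : exists U, List.In U D' /\ U x.
Proof. by have [U [UD Ux]] := coverD x; exists U; split=> //; exact: DD'. Qed.

(** The cycle is lifted to a singular one, made small for [D] by subdivision, and sent back by
    [nul]. *)
Lemma refine_surj c (q : fm F _) : inS (joinS (@allin X) D') q ->
  bdt q = c *: bas F [::] ->
  exists p q', [/\ inS (joinS (@allin X) D) p, inS (joinS (@allin X) D') q',
    bdt p = c *: bas F [::] & q = p + bdt q'].
Proof.
move=> Hq dq.
have [|y [q1 [Hy Hq1 dy ->]]] := qiso_surj nul_esimp bds_esimp (nul_qiso goodD') _ Hq dq.
  exact: small_esimp coverD'.
have [y1 [w [Hy1 Hw dy1 Ey]]] := small_surj openD coverD (small_all Hy) dy.
(* [w] fills [y - y1] but need not be small; since [y - y1] is small for [D'], a small filling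
   exists too. *)
have [|w2 Hw2 dw2] := small_inj openD' coverD' Hw.
  have -> : bds x0 w = y - y1 by rewrite Ey addrC addKr.
  by apply: inSB => //; apply: sub_inS Hy1 => s; exact: sub_join.
exists (nul y1), (nul w2 + q1); split.
- exact: nul_join.
- by apply: inSD => //; exact: nul_join.
- by rewrite -nul_bds dy1 linearZ /= nul_esimp.
- by rewrite linearD /= -nul_bds dw2 addrA -linearD /= -Ey.
Qed.

(** The filling over [D'] shows that a singular lift [y] of [p] bounds; subdivision makes a filling
    of [y] small for [D], and [nul] returns it to tuples. *)
Lemma refine_inj c (p q : fm F _) : inS (joinS (@allin X) D) p ->
  bdt p = c *: bas F [::] -> inS (joinS (@allin X) D') q -> bdt q = p ->
  exists2 p', inS (joinS (@allin X) D) p' & bdt p' = p.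
Proof.
move=> Hp dp Hq dq.
have [|y [p1 [Hy Hp1 dy Ep]]] := qiso_surj nul_esimp bds_esimp (nul_qiso goodD) _ Hp dp.
  exact: small_esimp coverD.
have Hy' : inS (joinS (sing x0) D') y by apply: sub_inS Hy => s; exact: sub_join.
have Hq' : inS (joinS (@allin X) D') (q - p1).
  by apply: inSB => //; apply: sub_inS Hp1 => s; exact: sub_join.
have [|w Hw dw] := qiso_inj (@bdt_bdt F X) nul_bds nul_esimp (nul_qiso goodD') Hy' Hq' dy.
  by rewrite linearB /= dq Ep addrK.
have [|w' Hw' dw'] := small_inj openD coverD (small_all Hw); first by rewrite dw.
exists (nul w' + p1); first by apply: inSD => //; exact: nul_join.
by rewrite linearD /= -nul_bds dw' dw.
Qed.
End Refine.
End Compare.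

(** * Grading and bases *)

Section Grading.
Local Open Scope ring_scope.
Variable F : fieldType.

Lemma res_comm (T T' : Type) (d : {linear fm F T -> fm F T'}) (S : T -> Prop)
    (S' : T' -> Prop) z :
  (forall t, S t -> inS S' (d (bas F t))) ->
  (forall t, ~ S t -> inS (fun u => ~ S' u) (d (bas F t))) ->
  d (res S z) = res S' (d z).
Proof.
move=> H1 H2; apply: (eq_lin_on (f := d \o res S) (g := res S' \o d)
  (S := fun _ => True)) => // t _ /=.
rewrite [X in d X]lin_bas; case: asboolP => St.
  by rewrite res_id //; exact: H1.
rewrite linear0; symmetry; apply: res0 (H2 _ St) _; by [].
Qed.

Definition homog (T : Type) (deg : T -> nat) (n : nat) : T -> Prop := fun t => deg t = n.

(** A homological degree is recovered by projecting to simplices with a given number of vertices.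
    The shift [m] is 1 for a boundary and 0 for [nul]. *)
Lemma res_comm_shift (T T' : Type) (d : {linear fm F T -> fm F T'}) (deg : T -> nat)
    (deg' : T' -> nat) (m : nat) :
  (forall t, inS (fun u => deg' u + m = deg t)%N (d (bas F t))) ->
  forall n z, d (res (homog deg (n + m)) z) = res (homog deg' n) (d z).
Proof.
move=> H n z; apply: res_comm => t Ht; apply: sub_inS (H t) => u.
  by rewrite /homog Ht => /addIn.
by move=> Eu Hu; apply: Ht; rewrite /homog -Hu.
Qed.

Lemma bdt_res (Y : Type) n (z : fm F (list Y)) :
  bdt (res (homog size n.+1) z) = res (homog size n) (bdt z).
Proof.
rewrite -addn1; apply: (res_comm_shift (d := @bdt F Y)) => s /=.
by rewrite bdt_bas; apply: sub_inS (@bd_tuple_face F Y s) => w [_ <-]; rewrite addn1.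
Qed.

Variables (X : MetricSpace) (x0 : X).

Lemma bds_res n (z : fm F (ssimp X)) :
  bds x0 (res (homog fst n.+1) z) = res (homog fst n) (bds x0 z).
Proof.
rewrite -addn1; apply: (res_comm_shift (d := @bds F X x0)) => s /=.
rewrite bds_bas; apply: (inS_linear (f := pushl x0 s)) (@bd_tuple_face F _ (verts s.1)).
move=> w [_ zw]; rewrite /= pushl_bas; apply: inS_bas.
by rewrite /= addn1 zw size_verts.
Qed.

Lemma nul_res n (z : fm F (ssimp X)) :
  nul (res (homog fst n) z) = res (homog size n) (nul z).
Proof.
rewrite -[n in LHS]addn0; apply: (res_comm_shift (d := @nul F X)) => s /=.
by rewrite nul_bas; apply: inS_bas; rewrite addn0 /vtuple size_map size_verts.
Qed.

Lemma res_scaled_bas (T : Type) (S : T -> Prop) c (o : T) :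
  exists c', res S (c *: bas F o) = c' *: bas F o.
Proof. by apply: inS1; apply: res_sub; apply: inSZ; exact: inS_bas. Qed.
End Grading.

(** * Finite bases modulo a subspace *)

Section Basis.
Local Open Scope ring_scope.
Variables (F : fieldType) (V : lmodType F).

Definition lc (a : seq F) (zs : seq V) : V := \sum_(x <- zip a zs) x.1 *: x.2.

Lemma lc_nil a : lc a [::] = 0.
Proof. by case: a => [|x a]; rewrite /lc big_nil. Qed.

Lemma lc_cons x a z zs : lc (x :: a) (z :: zs) = x *: z + lc a zs.
Proof. by rewrite /lc /= big_cons. Qed.

Lemma lc_lin b a a' : size a = size a' ->
  exists2 a'', size a'' = size a' & forall h, lc a'' h = b *: lc a h + lc a' h.
Proof.
elim: a a' => [|y a IHa] [|y' a'] // => [_|[/IHa[a'' sa Ha]]].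
  exists [::] => // h; rewrite /lc.
  by case: h => [|z h]; rewrite /= big_nil scaler0 addr0.
exists (b * y + y' :: a''); first by rewrite /= sa.
case=> [|z h]; first by rewrite !lc_nil scaler0 addr0.
by rewrite !lc_cons Ha scalerDl scalerDr -scalerA addrACA.
Qed.

Lemma lc_zeros zs : lc (nseq (size zs) 0) zs = 0.
Proof. by elim: zs => [|z zs IH]; rewrite ?lc_nil //= lc_cons scale0r add0r. Qed.

Definition subspace (Z : V -> Prop) : Prop :=
  Z 0 /\ forall a x y, Z x -> Z y -> Z (a *: x + y).

Lemma subspaceD Z x y : subspace Z -> Z x -> Z y -> Z (x + y).
Proof. by move=> [_ H] Zx Zy; rewrite -[x]scale1r; exact: H. Qed.

Lemma subspaceZ Z a x : subspace Z -> Z x -> Z (a *: x).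
Proof. by move=> [H0 H] Zx; rewrite -[_ *: _]addr0; exact: H. Qed.

Lemma subspaceN Z x : subspace Z -> Z x -> Z (- x).
Proof. by move=> H Zx; rewrite -scaleN1r; exact: subspaceZ. Qed.

Lemma subspaceB Z x y : subspace Z -> Z x -> Z y -> Z (x - y).
Proof. by move=> H Zx Zy; apply: subspaceD => //; exact: subspaceN. Qed.

Lemma subspace_lc Z a zs : subspace Z -> (forall z, List.In z zs -> Z z) -> Z (lc a zs).
Proof.
move=> H; elim: zs a => [|z zs IH] a Hz; first by rewrite lc_nil; case: H.
case: a => [|x a]; first by rewrite /lc /= big_nil; case: H.
rewrite lc_cons; apply: (proj2 H); first by apply: Hz; left.
by apply: IH => y yz; apply: Hz; right.
Qed.

Definition spanned (B Z : V -> Prop) (g : seq V) : Prop :=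
  forall z, Z z -> exists a, size a = size g /\ B (z - lc a g).

(** In the application the generators [g] are single tuples, not cycles, so a basis cannot be
    selected among them. Instead [Z] is cut down to the part [Z'] spanned by the tail of [g], and at
    most one vector outside it is added. *)
Lemma finite_basis B (g : seq V) : subspace B -> forall Z, subspace Z ->
  spanned B Z g ->
  exists zs, [/\ forall z, List.In z zs -> Z z,
    forall a, size a = size zs -> B (lc a zs) -> forall x, List.In x a -> x = 0 &
    spanned B Z zs].
Proof.
move=> HB; elim: g => [|x g IH] Z HZ Hs.
  by exists [::]; split=> // -[].
have [Hg|] := pselect (spanned B Z g); first by case: (IH Z HZ Hg) => zs; exists zs.
move=> /existsNP[z0 /not_implyP[Zz0 Nz0]].
have [[|c a0] [//= [sa0]]] := Hs z0 Zz0; rewrite lc_cons => Bz0.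
have c0 : c != 0.
  by apply/eqP => c0; apply: Nz0; exists a0; move: Bz0; rewrite c0 scale0r add0r.
pose Z' z := Z z /\ exists a, size a = size g /\ B (z - lc a g).
have sZ' : subspace Z'.
  split; first split; first by case: HZ.
    exists (nseq (size g) 0); split; first exact: size_nseq.
    by rewrite lc_zeros subr0; case: HB.
  move=> b y z [Zy [a [sa Ha]]] [Zz [a' [sa' Ha']]]; split; first by apply: (proj2 HZ).
  have [|a'' sa'' Ea] := @lc_lin b a a'; first by rewrite sa sa'.
  exists a''; split; first by rewrite sa''.
  by rewrite Ea opprD addrACA -scalerBr; apply: (proj2 HB).
have [|zs [Hzs Hind Hspan]] := IH Z' sZ'; first by move=> z [].
exists (z0 :: zs); split.
- by move=> y [<-|/Hzs[]].
- case=> // b a [sa]; rewrite lc_cons => Bb.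
  have b0 : b = 0.
    (* Otherwise dividing by [b] would express [z0] through the tail modulo [B], against its
       choice. *)
    apply/eqP; apply: contrapT => /negP b0; apply: Nz0.
    have [_ [a1 [sa1 Ba1]]] : Z' (lc a zs) by apply: subspace_lc sZ' _.
    have [|a2 sa2 Ea2] := @lc_lin (- b^-1) a1 (nseq (size g) 0); first by rewrite size_nseq.
    exists a2; split; first by rewrite sa2 size_nseq.
    have -> : lc a2 g = - b^-1 *: lc a1 g.
      by rewrite Ea2 lc_zeros addr0.
    have -> : z0 - - b^-1 *: lc a1 g =
      b^-1 *: (b *: z0 + lc a zs) - b^-1 *: (lc a zs - lc a1 g).
      rewrite scalerDr scalerA mulVf // scale1r scaleNr opprK scalerBr opprB.
      by rewrite -addrA [X in _ = _ + X]addrC subrK.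
    by apply: subspaceB => //; exact: subspaceZ.
  move: Bb; rewrite b0 scale0r add0r => /(Hind _ sa) Ha x' [<-|/Ha] //.
- move=> z1 Zz1; have [[|c1 a1] [//= [sa1]]] := Hs z1 Zz1; rewrite lc_cons => Bz1.
  (* This multiple of [z0] cancels the coefficient of [x], which puts [z2] in [Z']. *)
  pose z2 := - (c1 / c) *: z0 + z1.
  have Z2 : Z' z2.
    split; first by apply: (proj2 HZ).
    have [|a2 sa2 Ea2] := @lc_lin (- (c1 / c)) a0 a1; first by rewrite sa0 sa1.
    exists a2; split; first by rewrite sa2.
    have -> : z2 - lc a2 g = - (c1 / c) *: (z0 - (c *: x + lc a0 g)) +
        (z1 - (c1 *: x + lc a1 g)).
      have E (u v w y y' : V) : (- u + y) - (- w + y') = - (u - (v + w)) + (y - (v + y')).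
        by rewrite !opprD !opprK [RHS]addrACA; congr (_ + _); rewrite addrACA subrr add0r.
      have -> : c1 *: x = (c1 / c) *: (c *: x) by rewrite scalerA divfK.
      by rewrite Ea2 /z2 !scaleNr scalerBr scalerDr.
    exact: (proj2 HB).
  have [a [sa Ba]] := Hspan z2 Z2.
  exists ((c1 / c) :: a); split; first by rewrite /= sa.
  by move: Ba; rewrite /z2 lc_cons opprD addrA scaleNr [- _ + z1]addrC.
Qed.
End Basis.

(** * Chains of simplicial sets as elements of free modules *)

Section Model.
Local Open Scope ring_scope.
Variable F : fieldType.

(* The chains of a simplicial set [K] as elements of a free module: [mS k] singles out
   the basis elements that are genuine [k]-simplices, [o] is the empty simplex. *)
Record model (K : SSet) (T : Type) (d : {linear fm F T -> fm F T}) (o : T) := Model {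
  mi : forall k, simp K k -> T;
  mS : nat -> T -> Prop;
  m_eq : forall k (s t : simp K k), seqv s t <-> mi s = mi t;
  m_valid : forall k (s : simp K k), svalid s -> mS k (mi s);
  m_onto : forall k t, mS k t -> exists2 s : simp K k, svalid s & mi s = t;
  m_bd : forall k (s : simp K k.+1), svalid s ->
    d (bas F (mi s)) = \sum_(i <- iota 0 k.+2) (-1) ^+ i *: bas F (mi (@sface K k i s));
  m_face : forall k z, inS (mS k.+1) z -> inS (mS k) (d z);
  m_o : forall k, ~ mS k o;
  m_aug : forall t, mS 0 t -> d (bas F t) = bas F o }.

Section Chains.
Variables (K : SSet) (T : Type) (d : {linear fm F T -> fm F T}) (o : T).
Variable M : model K d o.

Definition toM k (c : chain F K k) : fm F T := \sum_(p <- c) p.1 *: bas F (mi M p.2).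

Lemma toM_cons k a s (c : chain F K k) : toM ((a, s) :: c) = a *: bas F (mi M s) + toM c.
Proof. by rewrite /toM big_cons. Qed.

Lemma toM_cat k (c c' : chain F K k) : toM (c ++ c') = toM c + toM c'.
Proof. by rewrite /toM big_cat. Qed.

Lemma coefE k (c : chain F K k) tau : coef c tau = cf (mi M tau) (toM c).
Proof.
elim: c => [|[a s] c IH]; first by rewrite /coef /toM !big_nil cf0.
rewrite toM_cons cfD cfZ cf_bas -IH /coef big_cons; congr (_ + _).
rewrite /Defs.decP; case: ClassicalEpsilon.excluded_middle_informative => /= H.
  by rewrite asboolT ?mulr1 //; apply/m_eq.
by rewrite asboolF ?mulr0 // => /m_eq.
Qed.

Lemma ceqE k (c c' : chain F K k) : ceq c c' <-> toM c = toM c'.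
Proof.
split=> [H|H tau]; last by rewrite !coefE H.
apply: fm_eqP => t; have [[s <-]|Ns] := pselect (exists s : simp K k, mi M s = t).
  by rewrite -!coefE.
have N0 (e : chain F K k) : cf t (toM e) = 0.
  elim: e => [|[a s] e IH]; first by rewrite /toM big_nil cf0.
  rewrite toM_cons cfD cfZ cf_bas IH addr0 asboolF ?mulr0 // => E.
  by apply: Ns; exists s.
by rewrite !N0.
Qed.

Lemma toM_scale k a (c : chain F K k) : toM (scale a c) = a *: toM c.
Proof.
rewrite /toM /scale big_map scaler_sumr; apply: eq_bigr => p _.
by rewrite scalerA.
Qed.

Lemma toM_csub k (c c' : chain F K k) : toM (csub c c') = toM c - toM c'.
Proof. by rewrite toM_cat toM_scale scaleN1r. Qed.

Lemma toM_lincomb k a (zs : seq (chain F K k)) : toM (lincomb a zs) = lc a (map (@toM k) zs).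
Proof.
rewrite /lincomb; elim: zs a => [|z zs IH] [|x a]; rewrite ?lc_nil //=;
  try by rewrite /toM /lc !big_nil.
by rewrite lc_cons toM_cat toM_scale IH.
Qed.

Lemma toM_valid k (c : chain F K k) : valid_chain c -> inS (mS M k) (toM c).
Proof.
elim: c => [|[a s] c IH] H; first by rewrite /toM big_nil; exact: inS0.
rewrite toM_cons; apply: inSD; last by apply: IH => p pc; apply: H; right.
by apply: inSZ; apply: inS_bas; apply: m_valid; apply: (H (a, s)); left.
Qed.

Lemma of_M k z : inS (mS M k) z -> exists2 c : chain F K k, valid_chain c & toM c = z.
Proof.
move: z; apply: inS_ind.
- by exists [::] => //; rewrite /toM big_nil.
- move=> x y [c Vc <-] [c' Vc' <-]; exists (c ++ c'); last by rewrite toM_cat.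
  by move=> p pc; case: (List.in_app_or _ _ _ pc) => [/Vc|/Vc'].
- move=> a t /(@m_onto _ _ _ _ M)[s Vs <-]; exists [:: (a, s)]; first by move=> p [<-|].
  by rewrite toM_cons /toM big_nil addr0.
Qed.

Lemma toM_bd k (c : chain F K k.+1) : valid_chain c -> toM (bd c) = d (toM c).
Proof.
elim: c => [|[a s] c IH] H; first by rewrite /toM /= !big_nil linear0.
have -> : bd ((a, s) :: c) =
  [seq ((-1) ^+ i * a, @sface K k i s) | i <- iota 0 k.+2] ++ bd c by [].
rewrite toM_cat toM_cons linearD linearZZ IH; last first.
  by move=> p pc; apply: H; right.
congr (_ + _); rewrite m_bd; last by apply: (H (a, s)); left.
rewrite scaler_sumr /toM big_map; apply: eq_bigr => i _.
by rewrite /= scalerA mulrC.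
Qed.

Definition rcycle z : Prop := exists c, d z = c *: bas F o.

(** In degree 0 every valid chain has a multiple of [o] as boundary. In higher degrees the boundary
    is supported on genuine simplices, among which [o] is not, so the multiple is 0. *)
Lemma is_cycleE k (c : chain F K k) : is_cycle c <-> valid_chain c /\ rcycle (toM c).
Proof.
case: k c => [|k] c.
  split=> [Vc|[]] //; split=> //.
  have : inS (mS M 0) (toM c) by exact: toM_valid.
  move: (toM c) => z.
  move: z; rewrite /rcycle.
  apply: inS_ind => [|x y [a Ea] [b Eb]|a t /(@m_aug _ _ _ _ M) Et].
  - by exists 0; rewrite linear0 scale0r.
  - by exists (a + b); rewrite linearD Ea Eb scalerDl.
  - by exists a; rewrite linearZ /= Et.
split=> [[Vc /ceqE]|[Vc [a Ea]]].
  rewrite toM_bd // => E; split=> //; exists 0; rewrite E /toM big_nil.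
  by rewrite scale0r.
split=> //; apply/ceqE; rewrite toM_bd // Ea /toM big_nil.
have : inS (mS M k) (d (toM c)) by apply: m_face; exact: toM_valid.
rewrite Ea => /(_ o).
rewrite cfZ cf_bas asboolT // mulr1 => H.
by have [->|/H/(@m_o _ _ _ _ M)] := eqVneq a 0; rewrite ?scale0r.
Qed.

Lemma is_bdryE k (c : chain F K k) :
  is_bdry c <-> exists2 w, inS (mS M k.+1) w & d w = toM c.
Proof.
split=> [[e [Ve /ceqE E]]|[w /of_M[e Ve <-] E]].
  by exists (toM e); [exact: toM_valid|rewrite -toM_bd].
by exists e; split=> //; apply/ceqE; rewrite toM_bd.
Qed.

Definition homol_cycle k z : Prop := inS (mS M k) z /\ rcycle z.
Definition homol_bdry k z : Prop := exists2 w, inS (mS M k.+1) w & d w = z.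
End Chains.

(** Both complexes are modelled in one free module where [f] is the identity; this covers the
    inclusion of Rips complexes and the identity of [Singular X]. *)
Lemma image_dim_intro (K1 K2 : SSet) (f : forall k, simp K1 k -> simp K2 k)
    (T : Type) (d : {linear fm F T -> fm F T}) (o : T)
    (M1 : model K1 d o) (M2 : model K2 d o) k (ys : seq (fm F T)) :
  (forall s, mi M2 (f k s) = mi M1 s) ->
  (forall y, List.In y ys -> homol_cycle M1 k y) ->
  (forall a, size a = size ys -> homol_bdry M2 k (lc a ys) ->
     forall x, List.In x a -> x = 0) ->
  (forall z, homol_cycle M1 k z -> exists a, size a = size ys /\
     homol_bdry M2 k (z - lc a ys)) ->
  image_dim F f k (size ys).
Proof.
move=> Hf Hys Hind Hspan.
have toMf (c : chain F K1 k) : toM M2 (cmap f c) = toM M1 c.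
  by rewrite /toM /cmap big_map; apply: eq_bigr => p _; rewrite /= Hf.
have [zs Ezs Czs] : exists2 zs : seq (chain F K1 k), map (toM M1 (k := k)) zs = ys &
    forall z, List.In z zs -> is_cycle z.
  elim: ys Hys {Hind Hspan} => [|y ys IH] H; first by exists [::].
  have [zs Ezs Czs] := IH (fun y' yy => H y' (or_intror yy)).
  have [/(@of_M _ _ _ _ M1)[c Vc Ec] Cy] := H y (or_introl erefl).
  exists (c :: zs) => [|z [<-|/Czs]] //=; first by rewrite Ezs Ec.
  by apply/(is_cycleE M1); rewrite Ec.
have sz : size zs = size ys by rewrite -Ezs size_map.
exists zs; split=> //; split=> //; split.
- move=> a sa /(is_bdryE M2); rewrite toMf toM_lincomb Ezs => Hb.
  exact: Hind.
- move=> z Cz; have [Vz Rz] := proj1 (is_cycleE M1 z) Cz.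
  have [|a [sa Ba]] := Hspan (toM M1 z); first by split=> //; exact: toM_valid.
  exists a; split=> //; apply/(is_bdryE M2).
  by rewrite toMf toM_csub toM_lincomb Ezs.
Qed.

Section RipsModel.
Variables (X : MetricSpace) (r : R).

Definition rips_simp (A : list X) (k : nat) (s : list X) : Prop :=
  size s = k.+1 /\ (forall x, List.In x s -> List.In x A) /\ diam_lt s r.

Definition rips_model (A : list X) : model (Rips A r) (@bdt F X) [::].
Proof.
refine (@Model (Rips A r) (list X) (@bdt F X) [::] (fun _ s => s) (rips_simp A) _ _ _ _ _ _ _).
- by [].
- by [].
- by move=> k t Ht; exists t.
- move=> k s [zs _] /=; rewrite bdt_bas bd_tuple_sum zs; exact: eq_bigr.
- move=> k z; apply: inS_linear => s [zs [As Ds]] /=; rewrite bdt_bas.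
  apply: sub_inS (@bd_tuple_face F X s) => w [ws zw]; split.
    by move: zw; rewrite zs => -[].
  by split=> [x /ws /As|x y /ws xs /ws ys] //; exact: Ds.
- by move=> k [].
- by move=> [|x [|y s]] [] // _ _; rewrite /= bdt_bas /= linear0 subr0.
Defined.
End RipsModel.

Section SingularModel.
Variables (X : MetricSpace) (x0 : X).

Definition sing_simp (k : nat) (s : ssimp X) : Prop :=
  s.1 = k.+1 /\ sing x0 (fun _ => True) s.

Lemma size_drop_at (T : Type) i (v : list T) : (i < size v)%N ->
  (size (drop_at i v)).+1 = size v.
Proof.
move=> iv; rewrite size_cat size_take size_drop iv.
by rewrite -addSn subnKC.
Qed.

Lemma size_insert_at (T : Type) i (a : T) (t : list T) : size (insert_at i a t) = (size t).+1.
Proof. by rewrite size_cat /= addnS -size_cat cat_take_drop. Qed.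

Lemma In_drop_at (T : Type) i (v : list T) x : List.In x (drop_at i v) -> List.In x v.
Proof.
move=> xd; case: (List.in_app_or _ _ _ xd) => H.
  by rewrite -(cat_take_drop i v); apply: List.in_or_app; left.
by rewrite -(cat_take_drop i.+1 v); apply: List.in_or_app; right.
Qed.

Lemma push_face n i (sig : list R -> X) : (i < n.+1)%N ->
  push x0 (n.+1, snorm x0 n.+1 sig) (drop_at i (verts n.+1)) =
  (n, snorm x0 n (fun t => sig (insert_at i 0%R t))).
Proof.
move=> lin; move: (verts n.+1) (size_verts n.+1) (@verts_in n.+1) (@comb_verts n.+1).
move=> v zv Sv Cv.
have zd : size (drop_at i v) = n.
  by apply/succn_inj; rewrite -zv size_drop_at // zv.
rewrite /push zd; congr (_, _); apply: eq_snorm => t St; rewrite [LHS]/=.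
have zt : size t = n by case: St.
rewrite snormE; first by rewrite -comb_insert ?zv ?zt // Cv // size_insert_at zt.
apply: simplex_comb; first by rewrite zd.
by move=> x xd; apply: Sv; exact: In_drop_at xd.
Qed.

Definition singular_model : model (Singular X) (@bds F X x0) (esimp x0).
Proof.
refine (@Model (Singular X) (ssimp X) (@bds F X x0) (esimp x0)
  (fun k sig => (k.+1, snorm x0 k.+1 sig)) sing_simp _ _ _ _ _ _ _).
- move=> k s t; split=> [H|[E]]; first by congr (_, _); exact: eq_snorm.
  by move=> u Su; rewrite -(@snormE _ x0 k.+1 s u Su) E snormE.
- move=> k s Vs; split=> //; split=> //; first exact: normal_snorm.
  exact: scont_snorm.
- move=> k [n sig] [/= -> [Hn Cs _]]; exists sig => //.
  by congr (_, _).
- move=> k s Vs; rewrite [LHS]bds_bas [(_, _).1]/= bd_tuple_sum linear_sum size_verts.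
  rewrite big_seq [RHS]big_seq; apply: eq_bigr => i; rewrite mem_iota add0n => /andP[_ ik].
  by rewrite linearZ /= pushl_bas push_face.
- move=> k z Hz.
  have H1 : inS (sing x0 (fun _ => True)) (bds x0 z).
    by apply: bds_in; [exact: stable_sing|apply: sub_inS Hz => s []].
  have H2 : inS (homog fst k.+1) (bds x0 z).
    rewrite -(@res_id _ _ (homog fst k.+2) z) ?bds_res; first exact: res_in.
    by apply: sub_inS Hz => s [].
  exact: inSI H2 H1.
- by move=> k [].
- move=> s [s1 [Hn _ _]]; rewrite /= bds_bas s1 /= linearB /= !pushl_bas !linear0 ?subr0 ?addr0.
  by congr bas; rewrite /push /=; apply: esimpE => //=; exact: normal_snorm.
Defined.
End SingularModel.
End Model.

(** * Finite samples *)

Section FiniteSets.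
Variable X : Type.

(** Lists [l] may repeat members and are infinitely many; the induction decides whether each [U] of
    [D] occurs in [l], and [P] records the positive answers. *)
Lemma hit_points (D : list (X -> Prop)) (P : X -> Prop) :
  exists A : list X, forall l, (forall U, List.In U l -> List.In U D) ->
    (exists x, P x /\ inter l x) -> exists x, List.In x A /\ (P x /\ inter l x).
Proof.
elim: D P => [|U D IH] P.
  have [[x Px]|NP] := pselect (exists x, P x).
    exists [:: x] => l Hl _; exists x; split; first by left.
    by split=> // V /Hl.
  by exists [::] => l _ [x [Px _]]; case: NP; exists x.
have [A1 H1] := IH P; have [A2 H2] := IH (fun x => P x /\ U x).
exists (A1 ++ A2) => l Hl [x [Px Ix]].
have [lD|/existsNP[V /not_implyP[Vl VD]]] :=
    pselect (forall V, List.In V l -> List.In V D).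
  have [|y [yA Hy]] := H1 l lD; first by exists x.
  by exists y; split=> //; apply: List.in_or_app; left.
have UV : U = V by case: (Hl V Vl).
(* The members of [l] in the tail; any other one is [U], already recorded in the new predicate. *)
pose l' := List.filter (fun V => `[< List.In V D >]) l.
have Hl' V' : List.In V' l' -> List.In V' D.
  by move=> /List.filter_In[_ /asboolP].
have [|y [yA [[Py Uy] Iy]]] := H2 l' Hl'.
  exists x; split; last by move=> W /List.filter_In[/Ix].
  by split=> //; rewrite UV; exact: Ix.
exists y; split; first by apply: List.in_or_app; right.
split=> // W Wl; have [WD|WD] := pselect (List.In W D).
  by apply: Iy; apply/List.filter_In; split=> //; apply/asboolP.
by case: (Hl W Wl) => // <-.
Qed.

(** Tuples over [A] are infinitely many but only their sets of entries matter: the induction decides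
    which points of [A] occur, collecting them in [p]. In the base case [p] and [s] have the same
    entries. *)
Lemma cover_subsets (C : (X -> Prop) -> Prop) (Q : list X -> Prop) :
  (forall s s', (forall x, List.In x s -> List.In x s') -> Q s' -> Q s) ->
  (forall s, Q s -> exists U, C U /\ allin U s) ->
  forall A p, exists D, (forall U, List.In U D -> C U) /\
    forall s, (forall x, List.In x s -> List.In x A \/ List.In x p) ->
      (forall x, List.In x p -> List.In x s) -> Q s ->
      exists U, List.In U D /\ allin U s.
Proof.
move=> HQ HC; elim=> [|a A IH] p.
  have [/HC[U [CU Up]]|NQ] := pselect (Q p).
    exists [:: U]; split=> [V [<-|]|s Hs _ _] //.
    by exists U; split; [left|move=> x /Hs[|/Up]].
  by exists [::]; split=> // s Hs ps Qs; case: NQ; exact: HQ Qs.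
have [D1 [C1 H1]] := IH p; have [D2 [C2 H2]] := IH (a :: p).
exists (D1 ++ D2); split.
  by move=> U UD; case: (List.in_app_or _ _ _ UD) => [/C1|/C2].
move=> s Hs ps Qs; have [sa|sa] := pselect (List.In a s).
  have [||U [UD Us]] := H2 s _ _ Qs.
  - move=> x xs; case: (Hs x xs) => [[->|xA]|xp]; first by right; left.
      by left.
    by right; right.
  - by move=> x [<-|/ps].
  by exists U; split=> //; apply: List.in_or_app; right.
have [|U [UD Us]] := H1 s _ ps Qs.
- move=> x xs; case: (Hs x xs) => [[ax|xA]|xp]; [|by left|by right].
  by case: sa; rewrite ax.
by exists U; split=> //; apply: List.in_or_app; left.
Qed.

Fixpoint tuples (A : list X) (n : nat) : list (list X) :=
  if n is n'.+1 then
    List.flat_map (fun s => List.map (fun a => a :: s) A) (tuples A n')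
  else [:: [::]].

Lemma tuplesP A s : (forall x, List.In x s -> List.In x A) -> List.In s (tuples A (size s)).
Proof.
elim: s => [|a s IH] H /=; first by left.
apply/List.in_flat_map; exists s; split.
  by apply: IH => x xs; apply: H; right.
by apply: (List.in_map (fun a => a :: s)); apply: H; left.
Qed.
End FiniteSets.

Section FiniteSpan.
Local Open Scope ring_scope.
Variable F : fieldType.

Lemma lc_bas (T : Type) (l : list T) z : inS (fun t => List.In t l) z ->
  exists2 a, size a = size l & lc a (map (@bas F T) l) = z.
Proof.
move: z; apply: inS_ind.
- exists (nseq (size l) 0); first exact: size_nseq.
  by rewrite -(size_map (@bas F T)) lc_zeros.
- move=> x y [a sa <-] [b sb <-].
  have [|c sc Ec] := @lc_lin F (fm F T) 1 a b; first by rewrite sa sb.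
  by exists c; rewrite ?sc // Ec scale1r.
- move=> c t; elim: l => [|u l IH] //= [->|/IH[a sa Ea]].
    exists (c :: nseq (size l) 0); first by rewrite /= size_nseq.
    by rewrite lc_cons -(size_map (@bas F T)) lc_zeros addr0.
  exists (0 :: a); first by rewrite /= sa.
  by rewrite lc_cons scale0r add0r.
Qed.
End FiniteSpan.

(** * Equality of the two dimensions *)

Section Main.
Local Open Scope ring_scope.
Variables (X : MetricSpace) (x0 : X) (r : R) (C : (X -> Prop) -> Prop).
Hypothesis openC : forall U, C U -> is_open U.
Hypothesis goodC : good_cover C.
Hypothesis ripsC : forall s : list X,
  (exists U, C U /\ forall x, List.In x s -> U x) <-> diam_lt s r.

Notation tups A D := (joinS (tup (fun x => List.In x A)) D).
Notation alls D := (joinS (@allin X) D).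
Notation sings D := (joinS (sing x0) D).

Lemma good_list D : (forall U, List.In U D -> C U) ->
  forall l, l <> [::] -> (forall U, List.In U l -> List.In U D) ->
  (forall x, ~ inter l x) \/ contractible (inter l).
Proof. by move=> HD l l0 lD; apply: goodC => // U /lD /HD. Qed.

Lemma tups_alls A D s : tups A D s -> alls D s.
Proof. by move=> [U [UD Hs]]; exists U; split=> // x /Hs[]. Qed.

Lemma tups_rips A D k s : (forall U, List.In U D -> C U) -> size s = k.+1 ->
  tups A D s -> rips_simp r A k s.
Proof.
move=> HD zs [U [/HD CU Hs]]; split=> //; split; first by move=> x /Hs[].
by apply/ripsC; exists U; split=> // x /Hs[].
Qed.

Definition hits (A : list X) (D : list (X -> Prop)) : Prop :=
  forall l, l <> [::] -> (forall U, List.In U l -> List.In U D) ->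
    (exists x, inter l x) -> exists x, List.In x A /\ inter l x.

Variables (D1 D2 : list (X -> Prop)) (X1 X2 : list X).
Hypothesis CD1 : forall U, List.In U D1 -> C U.
Hypothesis CD2 : forall U, List.In U D2 -> C U.
Hypothesis D12 : forall U, List.In U D1 -> List.In U D2.
Hypothesis coverD1 : forall x, exists U, List.In U D1 /\ U x.
Hypothesis hit1 : hits X1 D1.
Hypothesis hit2 : hits X2 D2.
Hypothesis X12 : forall x, List.In x X1 -> List.In x X2.
Hypothesis rips12 : forall s, (forall x, List.In x s -> List.In x X1) -> diam_lt s r ->
  exists U, List.In U D2 /\ allin U s.

Variable F : fieldType.

Notation mt := ([::] : list X).
Notation aug z := (exists c, bdt z = c *: bas F mt).

Lemma tups_nil A D : (exists U, List.In U D) -> tups A D mt.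
Proof. by move=> [U UD]; exists U. Qed.

Lemma D1_inhabited : exists U, List.In U D1.
Proof. by have [U [UD _]] := coverD1 x0; exists U. Qed.

Lemma tups_surj A D c (q : fm F (list X)) : (exists U, List.In U D) -> hits A D ->
  inS (alls D) q -> bdt q = c *: bas F mt ->
  exists p q', [/\ inS (tups A D) p, inS (alls D) q', bdt p = c *: bas F mt & q = p + bdt q'].
Proof.
move=> D0 H Hq dq.
by apply: (qiso_surj _ _ (incl_qiso H) _ Hq dq) => //; [rewrite /= bdt_bas|exact: tups_nil].
Qed.

Lemma tups_inj A D c (p q : fm F (list X)) : hits A D ->
  inS (tups A D) p -> inS (alls D) q -> bdt p = c *: bas F mt -> bdt q = p ->
  exists2 p', inS (tups A D) p' & bdt p' = p.
Proof.
move=> H Hp Hq dp dq.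
exact: (qiso_inj (f := idfun) (@bdt_bdt F X) _ _ (incl_qiso H) Hp Hq dp dq).
Qed.

(** The surjectivity half. A chain of Rips(X1, r) is small for [D2] by [rips12]; moving it into
    V(X1, D1) uses fillings with arbitrary points of [X], which [hit2] brings back into [X2]. *)
Lemma rips_to_tups k c (z : fm F (list X)) :
  inS (rips_simp r X1 k) z -> bdt z = c *: bas F mt ->
  exists p q, [/\ inS (tups X1 D1) p, inS (homog size k.+1) p, aug p,
    inS (rips_simp r X2 k.+1) q & z = p + bdt q].
Proof.
move=> Hz dz.
have Hz2 : inS (tups X2 D2) z.
  apply: sub_inS Hz => s [_ [sX Ds]]; have [U [UD Us]] := rips12 sX Ds.
  by exists U; split=> // x xs; split; [apply: X12; exact: sX|exact: Us].
have [p1 [q1 [Hp1 Hq1 dp1 Ez]]] := refine_surj x0 D12 (fun U UD => openC (CD2 UD)) coverD1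
  (good_list CD2) (sub_inS (@tups_alls X2 D2) Hz2) dz.
have [p [q2 [Hp Hq2 dp Ep]]] := tups_surj D1_inhabited hit1 Hp1 dp1.
(* Here [c = 0]: [z] and [p] have the same augmentation, so [z - p] is a true cycle. *)
have [||||q Hq dq] := @tups_inj X2 D2 0 (z - p) (q1 + q2) hit2.
- apply: inSB => //; apply: sub_inS Hp => s [U [UD Us]]; exists U.
  by split; [exact: D12|move=> x /Us[/X12 ? ?]].
- by apply: inSD => //; apply: sub_inS Hq2 => s; exact: sub_join.
- by rewrite linearB /= dz dp subrr scale0r.
- by rewrite linearD /= Ez Ep addrAC [p + _]addrC addrK addrC.
exists (res (homog size k.+1) p), (res (homog size k.+2) q); split.
- exact: res_sub.
- exact: res_in.
- case: k {Hz dz} => [|k]; last first.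
    by rewrite bdt_res dp; exact: res_scaled_bas.
  by rewrite bdt_res dp; exact: res_scaled_bas.
- apply: (sub_inS (S := fun s => homog size k.+2 s /\ tups X2 D2 s)).
    by move=> s [hs Hs]; exact: tups_rips Hs.
  by apply: inSI; [exact: res_in|exact: res_sub].
- rewrite bdt_res dq -linearD /= addrC subrK res_id //.
  by apply: sub_inS Hz => s [].
Qed.

Lemma rips_chain_cover A k (w : fm F (list X)) : inS (rips_simp r A k) w ->
  exists D, (forall U, List.In U D -> C U) /\ inS (alls D) w.
Proof.
move: w; apply: inS_ind.
- by exists [::]; split=> //; exact: inS0.
- move=> x y [D [CD Hx]] [D' [CD' Hy]]; exists (D ++ D'); split.
    by move=> U UD; case: (List.in_app_or _ _ _ UD) => [/CD|/CD'].
  by apply: inSD; [apply: sub_inS Hx|apply: sub_inS Hy] => s; apply: sub_join => U UD;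
    apply: List.in_or_app; [left|right].
- move=> a s [_ [_ /ripsC[U [CU Us]]]]; exists [:: U]; split=> [V [<-|]|] //.
  by apply: inSZ; apply: inS_bas; exists U; split=> //; left.
Qed.

(** The injectivity half. A filling [w] has finitely many simplices, hence is small for a finite [D]
    depending on it; [D1 ++ D] is then compared with [D1]. *)
Lemma tups_bound k c (p w : fm F (list X)) : inS (tups X1 D1) p ->
  bdt p = c *: bas F mt -> inS (rips_simp r X2 k) w -> bdt w = p ->
  exists2 p', inS (tups X1 D1) p' & bdt p' = p.
Proof.
move=> Hp dp Hw dw; have [D [CD HwD]] := rips_chain_cover Hw.
have CD' U : List.In U (D1 ++ D) -> C U.
  by move=> UD; case: (List.in_app_or _ _ _ UD) => [/CD1|/CD].
have Hp' : inS (alls D1) p by apply: sub_inS Hp => s; exact: tups_alls.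
have Hw' : inS (alls (D1 ++ D)) w.
  by apply: sub_inS HwD => s; apply: sub_join => U UD; apply: List.in_or_app; right.
have [|q Hq dq] := refine_inj x0 _ (fun U UD => openC (CD' U UD)) coverD1
  (good_list CD') Hp' dp Hw' dw.
  by move=> U UD; apply: List.in_or_app; left.
exact: tups_inj hit1 Hp Hq dp dq.
Qed.

Lemma subspace_inS (T : Type) (S : T -> Prop) : subspace (inS (F := F) S).
Proof.
by split=> [|a x y Hx Hy]; [exact: inS0|apply: inSD => //; exact: inSZ].
Qed.

Lemma subspace_rcycle (T T' : Type) (d : {linear fm F T -> fm F T'}) o :
  subspace (fun z => exists c, d z = c *: bas F o).
Proof.
split=> [|a x y [c Ec] [c' Ec']]; first by exists 0; rewrite linear0 scale0r.
by exists (a * c + c'); rewrite linearD linearZ /= Ec Ec' scalerA scalerDl.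
Qed.

Definition cycles1 n (z : fm F (list X)) : Prop :=
  [/\ inS (tups X1 D1) z, inS (homog size n) z & aug z].

(** The filling may have parts in any degree; its homogeneous part is extracted where a degree is
    required. *)
Definition bdries1 (z : fm F (list X)) : Prop := exists2 w, inS (tups X1 D1) w & bdt w = z.

Lemma subspace_cycles1 n : subspace (cycles1 n).
Proof.
have [A0 AD] := @subspace_rcycle _ _ (@bdt F X) mt.
split=> [|a x y [Hx hx Ax] [Hy hy Ay]]; first by split; [exact: inS0..|].
by split; [apply: (proj2 (subspace_inS _))..|exact: AD].
Qed.

Lemma subspace_bdries1 : subspace bdries1.
Proof.
split=> [|a x y [w Hw <-] [w' Hw' <-]]; first by exists 0; [exact: inS0|rewrite linear0].
exists (a *: w + w'); first by apply: (proj2 (subspace_inS _)).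
by rewrite linearD linearZ.
Qed.

(** This one list feeds both [rips_image_dim] and [sing_homology_dim]. *)
Lemma basis1 n : exists ys : seq (fm F (list X)),
  [/\ forall y, List.In y ys -> cycles1 n y,
    forall a, size a = size ys -> bdries1 (lc a ys) -> forall x, List.In x a -> x = 0 &
    spanned bdries1 (cycles1 n) ys].
Proof.
apply: (finite_basis (g := map (@bas F (list X)) (tuples X1 n)) subspace_bdries1
  (subspace_cycles1 n)) => z [Hz hz _].
have [|a sa Ea] := @lc_bas F (list X) (tuples X1 n) z.
  apply: sub_inS (inSI Hz hz) => s [[U [_ Hs]] <-]; apply: tuplesP => x /Hs[] //.
exists a; split; first by rewrite size_map.
by rewrite Ea subrr; case: subspace_bdries1.
Qed.

Lemma rips_image_dim k (ys : seq (fm F (list X))) :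
  (forall y, List.In y ys -> cycles1 k.+1 y) ->
  (forall a, size a = size ys -> bdries1 (lc a ys) -> forall x, List.In x a -> x = 0) ->
  spanned bdries1 (cycles1 k.+1) ys ->
  image_dim F (@rips_incl X X1 X2 r) k (size ys).
Proof.
move=> Hys Hind Hspan.
apply: (@image_dim_intro F _ _ _ _ _ _ (rips_model F r X1) (rips_model F r X2)) => //.
- move=> y /Hys[Hy hy [c Ec]]; split; last by exists c.
  by apply: sub_inS (inSI Hy hy) => s [Hs hs]; exact: tups_rips Hs.
- move=> a sa [w Hw dw]; apply: Hind => //.
  have [Hl _ [c Ec]] := subspace_lc a (subspace_cycles1 k.+1) Hys.
  by have [p' Hp' dp'] := tups_bound Hl Ec Hw dw; exists p'.
- move=> z [Hz [c dz]].
  have [p [q [Hp hp Ap Hq Ez]]] := rips_to_tups Hz dz.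
  have [|a [sa [w Hw dw]]] := Hspan p; first by split.
  exists a; split=> //; exists (res (homog size k.+2) w + q).
    apply: inSD => //.
    apply: (sub_inS (S := fun s => homog size k.+2 s /\ tups X1 D1 s)).
      move=> s [hs Hs]; have [zs [As Ds]] := tups_rips CD1 hs Hs.
      by split=> //; split=> // x /As /X12.
    by apply: inSI; [exact: res_in|exact: res_sub].
  rewrite linearD /= bdt_res dw res_id; first by rewrite Ez addrAC.
  by apply: inSB => //; have [_ ? _] := subspace_lc a (subspace_cycles1 k.+1) Hys.
Qed.

(** The corrections [us] are fixed and enter with the same coefficients, so relations transfer
    between the [ys] and the [vs]. *)
Lemma lift_to_sing n (ys : seq (fm F (list X))) : (forall y, List.In y ys -> cycles1 n y) ->
  exists vs us, [/\ size vs = size ys,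
    forall v, List.In v vs -> [/\ inS (sings D1) v, inS (homog fst n) v &
      exists c, bds x0 v = c *: bas F (esimp x0)],
    forall u, List.In u us -> inS (alls D1) u &
    forall a, lc a ys = nul (lc a vs) + bdt (lc a us)].
Proof.
elim: ys => [|y ys IH] Hys.
  by exists [::], [::]; split=> // a; rewrite !lc_nil !linear0 addr0.
have [vs [us [sv Hv Hu Hl]]] := IH (fun y' yy => Hys y' (or_intror yy)).
have [Hy hy [c Ec]] := Hys y (or_introl erefl).
have e1 : sings D1 (esimp x0).
  by have [U UD] := D1_inhabited; exists U; split=> //; exact: esimp_sing.
have Hy' : inS (alls D1) y by apply: sub_inS Hy => s; exact: tups_alls.
have [v [u [Hv1 Hu1 dv Ey]]] := qiso_surj (nul_esimp F x0) (bds_esimp F x0)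
  (nul_qiso (good_list CD1)) e1 Hy' Ec.
exists (res (homog fst n) v :: vs), (res (homog size n.+1) u :: us); split.
- by rewrite /= sv.
- move=> v' [<-|/Hv] //; split; [exact: res_sub|exact: res_in|].
  (* For [n = 0] there is no lower degree to project to, but the simplices then have no vertices and
     boundary 0. *)
  case: n {Hys IH Hv Hl hy} => [|n]; last by rewrite bds_res dv; exact: res_scaled_bas.
  exists 0; rewrite scale0r.
  have : inS (fun s => s.1 = 0%N) (res (homog fst 0%N) v) by exact: res_in.
  move: (res _ _); apply: inS_ind => [|x x' Hx Hx'|a s s0].
  + by rewrite linear0.
  + by rewrite linearD /= Hx Hx' addr0.
  + by rewrite linearZ /= bds_bas s0 /= linear0 scaler0.
- by move=> u' [<-|/Hu] //; exact: res_sub.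
- move=> [|b a]; first by rewrite /lc /= !big_nil !linear0 addr0.
  rewrite !lc_cons Hl -[in LHS](res_id hy) Ey !linearD !linearZ /= nul_res bdt_res.
  by rewrite ?scalerDr addrACA.
Qed.

Lemma sing_homology_dim k (ys : seq (fm F (list X))) :
  (forall y, List.In y ys -> cycles1 k.+1 y) ->
  (forall a, size a = size ys -> bdries1 (lc a ys) -> forall x, List.In x a -> x = 0) ->
  spanned bdries1 (cycles1 k.+1) ys ->
  homology_dim F (Singular X) k (size ys).
Proof.
move=> Hys Hind Hspan; have [vs [us [sv Hv Hu Hl]]] := lift_to_sing Hys.
have openD1 U (UD : List.In U D1) : is_open U := openC (CD1 UD).
have Hlu a : inS (alls D1) (lc a us) by apply: subspace_lc Hu; exact: subspace_inS.
have Hlv a : inS (sings D1) (lc a vs).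
  by apply: subspace_lc; [exact: subspace_inS|move=> v /Hv[]].
have hlv a : inS (homog fst k.+1) (lc a vs).
  by apply: subspace_lc; [exact: subspace_inS|move=> v /Hv[]].
rewrite -sv; apply: (@image_dim_intro F _ _ _ _ _ _ (singular_model F x0)
  (singular_model F x0)) => //.
- move=> v /Hv[sv' hv [c Ec]]; split; last by exists c.
  by apply: inSI hv _; exact: small_all sv'.
- move=> a sa [w Hw dw]; apply: Hind; first by rewrite sa.
  have [||w' Hw' dw'] := @small_inj F X x0 D1 openD1 coverD1 w.
  + by apply: sub_inS Hw => s [].
  + by rewrite dw.
  have [Ht _ [c Ec]] := subspace_lc a (subspace_cycles1 k.+1) Hys.
  have [||p' Hp' dp'] := tups_inj (q := nul w' + lc a us) hit1 Ht _ Ec.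
  + by apply: inSD => //; exact: nul_join Hw'.
  + by rewrite linearD /= -(nul_bds x0) dw' dw Hl.
  by exists p'.
- move=> z [Hz [c dz]].
  have [z1 [w [Hz1 Hw dz1 Ez]]] := small_surj openD1 coverD1
    (sub_inS (fun s (Hs : sing_simp x0 k s) => proj2 Hs) Hz) dz.
  have [p [q [Hp Hq dp Ep]]] : exists p q, [/\ inS (tups X1 D1) p, inS (alls D1) q,
      bdt p = c *: bas F mt & nul z1 = p + bdt q].
    apply: tups_surj D1_inhabited hit1 _ _; first exact: nul_join Hz1.
    by rewrite -(nul_bds x0) dz1 linearZ /= nul_esimp.
  have [|a [sa [b Hb db]]] := Hspan (res (homog size k.+1) p).
    split; [exact: res_sub|exact: res_in|].
    by rewrite bdt_res dp; exact: res_scaled_bas.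
  exists a; split; first by rewrite sv.
  have Hu' := subspace_lc a (@subspace_rcycle _ _ (@bds F X x0) (esimp x0))
    (fun v vv => let: And3 _ _ H := Hv v vv in H).
  have [c1 E1] : exists c1, bds x0 (res (homog fst k.+1) z1 - lc a vs) = c1 *: bas F (esimp x0).
    apply: (subspaceB (@subspace_rcycle _ _ (@bds F X x0) (esimp x0)) _ Hu').
    by rewrite /= bds_res dz1; exact: res_scaled_bas.
  (* The filling has three parts, up to projection to the degree: [q] leads from [nul z1] to [p],
     [b] from [p] to [lc a ys], and [lc a us] from there to [nul (lc a vs)]. *)
  have [|||w' Hw' dw'] := qiso_inj (p := res (homog fst k.+1) z1 - lc a vs)
    (q := b + res (homog size k.+2) q + lc a us)
    (@bdt_bdt F X) (@nul_bds F X x0)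
    (nul_esimp F x0) (nul_qiso (good_list CD1)) _ _ E1.
  + by apply: inSB => //; exact: res_sub.
  + apply: inSD => //; apply: inSD; last exact: res_sub.
    by apply: sub_inS Hb => s; exact: tups_alls.
  + rewrite /= [nul (_ - _)]linearB [bdt (_ + _)]linearD /= [bdt (b + _)]linearD /=.
    rewrite db nul_res Ep [res _ (_ + _)]linearD /= bdt_res Hl.
    rewrite -!addrA; congr (_ + _); rewrite opprD -!addrA.
    by rewrite (addrC (- bdt (lc a us))) addrK addrC.
  exists (res (homog fst k.+2) (w' + w)).
    apply: inSI; first exact: res_in.
    by apply: res_sub; apply: inSD => //; exact: small_all Hw'.
  have hz : inS (homog fst k.+1) z by apply: sub_inS Hz => s [].
  have Hh : inS (homog fst k.+1) (res (homog fst k.+1) z1 - lc a vs).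
    by apply: inSB => //; exact: res_in.
  rewrite /= bds_res [bds x0 (_ + _)]linearD [res _ (_ + _)]linearD /= dw' (res_id Hh).
  by rewrite -[in RHS](res_id hz) Ez [res _ (z1 + _)]linearD /= addrAC.
Qed.
End Main.

Lemma hits_exist (X : MetricSpace) (D : list (X -> Prop)) : exists A, hits A D.
Proof.
have [A HA] := hit_points D (fun _ => True); exists A => l _ lD [x Ix].
by have [|y [yA [_ Iy]]] := HA l lD; [exists x|exists y].
Qed.

Theorem mainTheorem16 (X : MetricSpace) (r : R) (C : (X -> Prop) -> Prop) :
  compact_space X -> (0 < r)%R ->
  open_cover C -> good_cover C ->
  (forall s : list X, (exists U, C U /\ forall x, List.In x s -> U x) <-> diam_lt s r) ->
  exists X1 X2 : list X,
    (forall x, List.In x X1 -> List.In x X2) /\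
    forall (k : nat) (F : fieldType), exists n : nat,
      homology_dim F (Singular X) k n /\
      image_dim F (@rips_incl X X1 X2 r) k n.
Proof.
move=> compX _ [openC covC] goodC ripsC.
(* Normal forms of singular simplices need a point [x0]. In the empty space both dimensions are 0: a
   raw singular simplex would take a value, and the empty list is not a valid Rips simplex. *)
have [[x0]|X0] := pselect (inhabited X); last first.
  exists nil, nil; split=> // k F; exists 0%N; split; exists [::]; split=> //; split=> //; split.
  - by move=> [].
  - move=> [|[a s] z] _; last by case: X0; exact: (inhabits (s [::])).
    by exists [::]; split=> //; exists [::]; split.
  - by move=> [].
  - move=> [|[a [|x s]] z] Hz; last by case: X0; exact: (inhabits x).
      by exists [::]; split=> //; exists [::]; split.
    have : @valid_chain F (Rips [::] r) k ((a, [::]) :: z) by case: k z Hz => [|k] z Hz; [exact: Hz|exact: (proj1 Hz)].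
    by move=> /(_ (a, [::]) (or_introl erefl)) [].
have [l Hl] := compX {U | C U} (fun U => sval U) (fun U => openC _ (svalP U))
  (fun x => let: ex_intro U (conj CU Ux) := covC x in ex_intro _ (exist _ U CU) Ux).
pose D1 := map sval l.
have CD1 U : List.In U D1 -> C U by move=> /(@In_map _ _ _ _ _)[V _ <-]; exact: svalP.
have coverD1 x : exists U, List.In U D1 /\ U x.
  by have [V [Vl Vx]] := Hl x; exists (sval V); split=> //; exact: map_In.
have [X1 hit1] := hits_exist D1.
have [||D [CD HD]] := @cover_subsets X C (fun s => diam_lt s r) _ _ X1 [::].
- by move=> s s' ss' Ds x y /ss' xs /ss' ys; exact: Ds.
- by move=> s /ripsC.
pose D2 := D1 ++ D.
have CD2 U : List.In U D2 -> C U.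
  by move=> UD; case: (List.in_app_or _ _ _ UD) => [/CD1|/CD].
have D12 U : List.In U D1 -> List.In U D2 by move=> UD; apply: List.in_or_app; left.
have [A hitA] := hits_exist D2.
have hit2 : hits (X1 ++ A) D2.
  move=> s s0 sD /(hitA s s0 sD)[x [xA Ix]].
  by exists x; split=> //; apply: List.in_or_app; right.
have X12 x : List.In x X1 -> List.In x (X1 ++ A) by move=> xX; apply: List.in_or_app; left.
have rips12 s : (forall x, List.In x s -> List.In x X1) -> diam_lt s r ->
    exists U, List.In U D2 /\ allin U s.
  move=> sX Ds; have [||U [UD Us]] := HD s _ _ Ds; [by move=> x /sX; left|by []|].
  by exists U; split=> //; apply: List.in_or_app; right.
exists X1, (X1 ++ A); split=> // k F.
have [ys [Hys Hind Hspan]] := @basis1 X D1 X1 F k.+1.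
exists (size ys); split.
  exact: (sing_homology_dim x0 openC goodC CD1 coverD1 hit1 Hys Hind Hspan).
exact: (rips_image_dim x0 openC goodC ripsC CD1 CD2 D12 coverD1 hit1 hit2 X12 rips12
  Hys Hind Hspan).
Qed.
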